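(* For every fixed $C>0$ there exists $\delta_C>0$ depending only on $C$ such that, for every $a_0\in\{1,2,3,5,6\}$ and all sufficiently large $X$, $$\#\mathcal{E}_{C,a_0}(X)\geqslant\delta_C X.$$
   Context: For $C>0$, $a_0\in\{1,2,3,5,6\}$ and $X\geqslant 3$, $\mathcal{E}_{C,a_0}(X)$ denotes the set of integers $n$ with $X<n\leqslant 2X$ and $n\equiv a_0\pmod 8$ such that $n\neq x^2+y^2+z^2$ for all $x,y,z\in\mathbb{Z}$ with $|z|\leqslant C\sqrt{\log n}$. *)

(* Defs.v *)
From mathcomp Require Import all_boot all_order all_algebra.
From mathcomp Require Import finmap.
From mathcomp Require Import zify.
From mathcomp Require Import all_classical all_reals all_analysis.

Set Implicit Arguments.
Unset Strict Implicit.
Unset Printing Implicit Defensive.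

Import Order.TTheory GRing.Theory Num.Theory.
Local Open Scope classical_set_scope.
Local Open Scope ring_scope.

Definition short_sum3sq (R : realType) (C : R) (n : int) : Prop :=
  exists x y z : int,
    `|z|%:~R <= C * Num.sqrt (ln (n%:~R : R)) /\ n = x ^+ 2 + y ^+ 2 + z ^+ 2.

Definition exceptional (R : realType) (C : R) (a0 : int) (X : R) : set int :=
  [set n : int | [/\ X < n%:~R <= 2 * X, (n = a0 %[mod 8])%Z &
                     ~ short_sum3sq C n]].

(* The cardinality `fset_set` is a junk value on infinite sets; this shows that
   the junk value is never taken. *)
Lemma finite_exceptional (R : realType) (C : R) (a0 : int) (X : R) :
  finite_set (exceptional C a0 X).
Proof.
pose N := (Num.truncn (`|X| *+ 2)).+1.
apply: (@sub_finite_set _ _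
  ((fun k : nat => (k%:Z - N%:Z)) @` `I_(N.*2.+1))); last first.
  exact/finite_image/finite_II.
move=> n [/andP[Xn nX] _ _].
have hN : `|X| *+ 2 < N%:R by exact: truncnS_gt.
have n0 : `|n%:~R : R| < N%:R.
  apply: le_lt_trans hN; rewrite ler_norml; apply/andP; split.
    apply: le_trans (ltW Xn); apply: le_trans (_ : - `|X| <= _).
      by rewrite lerN2 mulr2n lerDl.
    by rewrite lerNl -normrN ler_norm.
  by apply: (le_trans nX); rewrite mulr_natl lerMn2r ler_norm orbT.
have {}n0 : `|n| < N%:Z by rewrite -(ltr_int R) intr_norm.
exists (absz (n + N%:Z)); rewrite /=; first lia.
lia.
Qed.

(* Main.v *)
(* A first-moment argument. Let W be the product of q^2 over the primes
   q = 3 mod 4 up to a large constant y, M = 8W, and restrict n to the class mod M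
   with n = a0 mod 8 and n = 1 mod W. If z^2 = 1 mod q but z^2 <> 1 mod q^2, then
   q divides n - z^2 exactly once, so n - z^2 is not a sum of two squares; the
   remaining z have density D = prod_q (1 - 2/q + 2/q^2). For each of them
   Selberg's sieve, applied to the events "p divides n - z^2 exactly once" for the
   primes p = 3 mod 4 with y < p <= Q, bounds the density of the n for which n - z^2
   is a sum of two squares by O(1 / (P sqrt(log Q))), P = prod_q (1 - 1/q), with an
   absolute constant. There are O_C(sqrt(log X)) values of z, so the expected number
   of representations is O_C(D / P), and D / P tends to 0 as y grows because
   D / P <= prod_q (1 - 1/(2q)).

   The lower bound sqrt(log Q) for the sieve sum needs no information on primes:
   factoring the integers up to Q gives H(Q) <= 6 B P^-1 L, where H is the harmonic
   sum, L the sieve sum and B the sum of 1/n over n <= Q with all prime factors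
   1 mod 4; with r(n) = sum_{d | n} chi4(d) >= 0 one has
   B^2 <= sum_{n <= Q^2} r(n)/n <= H(Q^2), since the partial sums of chi4(e)/e are at
   most 1. The same inequality with no sieving primes shows that P tends to 0. *)

Require Import Defs.
From mathcomp Require Import finmap.
From mathcomp Require Import all_classical all_reals all_analysis.
(* After mathcomp-analysis, so that the finset names prevail over those of classical_sets. *)
From mathcomp Require Import all_boot all_order all_algebra.
From mathcomp Require Import cyclic zify ring lra.

Set Implicit Arguments.
Unset Strict Implicit.
Unset Printing Implicit Defensive.

Import Order.TTheory GRing.Theory Num.Theory.

(** * Sums of two squares and the primes 3 mod 4 *)

Lemma sqrn_pred p : 1 < p -> (p - 1) ^ 2 = (p - 2) * p + 1.
Proof. by case: p => [|[|q]] // _; rewrite subn1 /= !subSS subn0; ring. Qed.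

(** Here [p - 1] plays the role of -1. If [p] does not divide [x], it does not divide [y] either;
    raising x^2 = -y^2 to the odd power [m] = (p - 1)/2 and applying Fermat to both sides gives 1 =
    -1 mod [p]. *)
Lemma dvdn_sum_two_squares (p x y : nat) :
  prime p -> p %% 4 = 3 -> p %| x ^ 2 + y ^ 2 -> p %| x.
Proof.
move=> pp p3 pxy; apply: contraT => npx.
have npy : ~~ (p %| y).
  apply: contra npx => py; move: pxy.
  have py2 : p %| y ^ 2 by rewrite Euclid_dvdX // py.
  by rewrite dvdn_addl // Euclid_dvdX // andbT.
have fermat z : ~~ (p %| z) -> z ^ p.-1 = 1 %[mod p].
  move=> npz; apply/eqP; rewrite -totient_prime //.
  apply/eqP; apply: Euler_exp_totient; rewrite coprime_sym.
  by rewrite prime_coprime.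
have [m [pE modd]] : exists m, p.-1 = 2 * m /\ odd m.
  exists (2 * (p %/ 4) + 1).
  rewrite oddD oddM /=; split=> //.
  by rewrite [in LHS](divn_eq p 4) p3; move: (p %/ 4) => q; lia.
have : x ^ 2 = (p - 1) * y ^ 2 %[mod p].
  apply/eqP; rewrite -(eqn_modDr (y ^ 2)).
  by rewrite -mulSnr -subSn ?prime_gt0 // subn1 /= (eqP pxy) modnMr.
have pm1 : (p - 1) ^ m = p - 1 %[mod p].
  have sq : (p - 1) ^ 2 = 1 %[mod p].
    by rewrite sqrn_pred ?prime_gt1 // modnMDl.
  rewrite -(odd_double_half m) modd expnD expn1 -muln2 mulnC.
  rewrite -modnMml (mulnC _ 2) expnM -modnXm sq modnXm exp1n.
  by rewrite modnMml mul1n.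
move=> xy.
have : 1 = (p - 1) * 1 %[mod p].
  rewrite -[in LHS](fermat _ npx) -modnMmr -[in RHS](fermat _ npy) pE.
  rewrite modnMmr !expnM -modnXm xy modnXm expnMn.
  by rewrite -modnMml pm1 modnMml.
have := prime_gt1 pp; rewrite muln1 => p1.
rewrite !modn_small ?ltn_subrL ?(ltnW p1) // => p2.
suff p2' : p = 2 by move: p3; rewrite p2'.
by rewrite -(subnK (ltnW p1)) -p2.
Qed.

(** This is the obstruction behind the whole argument: an integer divisible exactly once by a prime
    3 mod 4 is not a sum of two squares. *)
Lemma sum_two_squares_even_val (p m x y : nat) :
  prime p -> p %% 4 = 3 -> m = x ^ 2 + y ^ 2 -> p %| m -> p ^ 2 %| m.
Proof.
move=> pp p3 -> pxy.
have px := dvdn_sum_two_squares pp p3 pxy.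
have py : p %| y by apply: (@dvdn_sum_two_squares p y x); rewrite // addnC.
by rewrite dvdn_add // dvdn_exp2r.
Qed.

(** * Counting integers in periodic sets *)

Definition periodic (W : nat) (P : pred nat) := forall n, P (n + W) = P n.

Lemma periodic_mod W P n : periodic W P -> P (n %% W) = P n.
Proof.
move=> perP; rewrite [in RHS](divn_eq n W) addnC.
elim: (n %/ W) => [|q IH]; first by rewrite mul0n addn0.
by rewrite mulSn addnCA addnC perP IH.
Qed.

Lemma periodic_dvd W V P : W %| V -> periodic W P -> periodic V P.
Proof.
move=> WV perP n; rewrite -(periodic_mod (n + V) perP) -(periodic_mod n perP).
by rewrite -modnDmr (eqP WV) addn0.
Qed.

Definition residue_count (W : nat) (P : pred nat) := count P (iota 0 W).

Lemma count_period W P a : periodic W P -> count P (iota a W) = residue_count W P.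
Proof.
move=> perP; elim: a => [//|a IH]; rewrite -IH.
case: W perP IH => [//|W] perP _.
rewrite (_ : iota a.+1 W.+1 = iota a.+1 W ++ [:: a.+1 + W]); last first.
  by rewrite -{1}(addn1 W) iotaD.
by rewrite count_cat /= addn0 addnC addSnnS perP.
Qed.

Lemma count_periods W P a q :
  periodic W P -> count P (iota a (q * W)) = q * residue_count W P.
Proof.
move=> perP; elim: q a => [//|q IH] a.
by rewrite !mulSn iotaD count_cat count_period // IH.
Qed.

Lemma count_iota_le P a m n : m <= n -> count P (iota a m) <= count P (iota a n).
Proof. by move=> /subnKC<-; rewrite iotaD count_cat leq_addr. Qed.

Lemma count_periodic_bounds W P a n : 0 < W -> periodic W P ->
  (n %/ W) * residue_count W P <= count P (iota a n) <= (n %/ W).+1 * residue_count W P.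
Proof.
move=> W0 perP; rewrite -!(count_periods a _ perP).
by rewrite !count_iota_le ?leq_trunc_div // ltnW // ltn_ceil.
Qed.

Lemma residue_count_card W P : residue_count W P = #|[pred i : 'I_W | P i]|.
Proof.
rewrite /residue_count -val_enum_ord count_map -sum1_card big_mkcond.
rewrite -sum1_count big_enum_cond /= -big_mkcond /=.
by apply: eq_bigl.
Qed.

(** By the Chinese remainder theorem, reduction modulo [a] and [b] is a bijection from the residues
    mod [a * b] to the pairs of residues. *)
Lemma residue_countM a b P Q : coprime a b -> 0 < a -> 0 < b ->
  periodic a P -> periodic b Q ->
  residue_count (a * b) (predI P Q) = residue_count a P * residue_count b Q.
Proof.
move=> cab a0 b0 pP pQ; rewrite !residue_count_card.
rewrite -cardX.
have ab0 : 0 < a * b by rewrite muln_gt0 a0.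
pose f (i : 'I_(a * b)) := (Ordinal (ltn_pmod i a0), Ordinal (ltn_pmod i b0)).
have f_inj : injective f.
  move=> i j [/eqP ia /eqP ib]; apply: val_inj => /=; apply/eqP.
  rewrite -(modn_small (ltn_ord i)) -(modn_small (ltn_ord j)).
  by rewrite chinese_remainder // ia ib.
rewrite -(fintype.card_image f_inj); apply: eq_card => -[u v].
rewrite !inE /=; apply/imageP/andP => [[i /andP[/= Pi Qi] [-> ->]]|[Pu Qv]].
  by rewrite /= !periodic_mod.
have lt : chinese a b u v %% (a * b) < a * b by rewrite ltn_pmod.
have ea : chinese a b u v %% (a * b) %% a = u.
  by rewrite modn_dvdm ?dvdn_mulr // chinese_modl // modn_small.
have eb : chinese a b u v %% (a * b) %% b = v.
  by rewrite modn_dvdm ?dvdn_mull // chinese_modr // modn_small.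
exists (Ordinal lt); last by congr (_, _); apply: val_inj; rewrite /= ?ea ?eb.
by rewrite inE /= -(periodic_mod _ pP) -(periodic_mod _ pQ) ea eb; apply/andP.
Qed.

(** Periodicity and count share one induction, because multiplicativity of the count requires the
    conjunction over the tail to be periodic. *)
Lemma residue_count_all (I : eqType) (s : seq I) (m : I -> nat) (P : I -> pred nat) :
  uniq s -> (forall i, i \in s -> 0 < m i) ->
  (forall i j, i \in s -> j \in s -> i != j -> coprime (m i) (m j)) ->
  (forall i, i \in s -> periodic (m i) (P i)) ->
  periodic (\prod_(i <- s) m i) (fun n => all (fun i => P i n) s) /\
  residue_count (\prod_(i <- s) m i) (fun n => all (fun i => P i n) s) =
    \prod_(i <- s) residue_count (m i) (P i).
Proof.
elim: s => [|i s IH]; first by rewrite !big_nil.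
move=> /= /andP[nis us] m0 com per; rewrite !big_cons.
have sub j : j \in s -> j \in i :: s by rewrite inE orbC => ->.
have [||||perS IHs] := IH.
- by [].
- by move=> j /sub; apply: m0.
- by move=> j k /sub js /sub ks; apply: com.
- by move=> j /sub; apply: per.
have peri : periodic (m i) (P i) by apply: per; rewrite inE eqxx.
have cop : coprime (m i) (\prod_(j <- s) m j).
  rewrite big_seq; apply: (big_ind (fun x => coprime (m i) x)).
  - exact: coprimen1.
  - by move=> x y cx cy; rewrite coprimeMr cx.
  - move=> j js; apply: com; rewrite ?inE ?eqxx ?js ?orbT //.
    by apply: contraNneq nis => ->.
split.
  move=> n /=.
  by rewrite (periodic_dvd (dvdn_mulr _ (dvdnn _)) peri)
             (periodic_dvd (dvdn_mull _ (dvdnn _)) perS).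
rewrite -IHs -residue_countM //; first by apply: m0; rewrite inE eqxx.
by rewrite big_seq; apply: prodn_cond_gt0 => j js; rewrite m0 // sub.
Qed.

Lemma residue_count_eqmod W a : 0 < W -> residue_count W (fun n => n == a %[mod W]) = 1.
Proof.
move=> W0; rewrite residue_count_card -(card1 (Ordinal (ltn_pmod a W0))).
by apply: eq_card => i; rewrite !inE modn_small.
Qed.

Lemma periodic_eqmod W a : periodic W (fun n => n == a %[mod W]).
Proof. by move=> n; rewrite modnDr. Qed.

Lemma residue_countD W P Q : subpred Q P ->
  residue_count W (predD P Q) = residue_count W P - residue_count W Q.
Proof.
move=> sQP; rewrite /residue_count; set s := iota _ _.
rewrite -(addnK (count Q s) (count (predD P Q) s)); congr (_ - _).
rewrite -count_predUI (@eq_count _ (predI _ Q) pred0) ?count_pred0 ?addn0.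
  by apply: eq_count => n /=; case: (boolP (Q n)) => [/sQP->|]; rewrite ?andbT ?orbF.
by move=> n /=; case: (Q n); rewrite ?andbF.
Qed.

(* p divides n - m exactly once, stated without a subtraction so that it is
   meaningful and periodic in n also for n < m. *)
Definition exactly_divides_diff (p m n : nat) :=
  (n == m %[mod p]) && (n != m %[mod p ^ 2]).

Lemma eqmod_sub p m n : n == m %[mod p ^ 2] -> n == m %[mod p].
Proof.
by move=> /eqP e; rewrite -(@modn_dvdm (p ^ 2) n) ?e ?modn_dvdm // dvdn_exp.
Qed.

Lemma periodic_exactly_divides_diff p m : periodic (p ^ 2) (exactly_divides_diff p m).
Proof.
by move=> n; rewrite /exactly_divides_diff modnDr -mulnn -modnDmr modnMr addn0.
Qed.

Lemma residue_count_exactly_divides_diff p m : 0 < p ->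
  residue_count (p ^ 2) (exactly_divides_diff p m) = p - 1.
Proof.
move=> p0.
have -> : residue_count (p ^ 2) (exactly_divides_diff p m) = residue_count (p ^ 2)
    (predD (fun n => n == m %[mod p]) (fun n => n == m %[mod p ^ 2])).
  by apply: eq_count => n; rewrite /= andbC.
rewrite residue_countD; last by move=> n /=; apply: eqmod_sub.
rewrite residue_count_eqmod ?expn_gt0 ?p0 //; congr (_ - _).
rewrite -mulnn [LHS]count_periods; last exact: periodic_eqmod.
by rewrite residue_count_eqmod // muln1.
Qed.

Lemma residue_count_le2 W (P : pred nat) (u v : nat) :
  (forall n, n < W -> P n -> n = u \/ n = v) -> residue_count W P <= 2.
Proof.
move=> uv; rewrite /residue_count -size_filter.
rewrite (@uniq_leq_size _ _ [:: u; v]) ?filter_uniq ?iota_uniq // => n.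
rewrite mem_filter mem_iota add0n => /andP[Pn nW].
by rewrite !inE; case: (uv n nW Pn) => ->; rewrite eqxx ?orbT.
Qed.

(** The roots 1 and [p - 1] of z^2 = 1 mod [p] lift to at least [p.*2] residues mod [p ^ 2], of
    which at most two satisfy the congruence mod [p ^ 2]. Divided by [p ^ 2], the bound is the
    factor 1 - 2/p + 2/p^2 of [survivor_density]. *)
Lemma residue_count_square_one p : prime p -> odd p ->
  residue_count (p ^ 2) (fun z => ~~ exactly_divides_diff p (z ^ 2) 1)
    <= p ^ 2 - p.*2 + 2.
Proof.
move=> pp oddp; have p0 := prime_gt0 pp; have p1 := prime_gt1 pp.
have p2 : 2 < p by rewrite odd_prime_gt2.
pose A z := 1 == z ^ 2 %[mod p]; pose B z := 1 == z ^ 2 %[mod p ^ 2].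
have sBA : subpred B A by move=> z /eqmod_sub.
have perA : periodic p A by move=> z; rewrite /A -modnXm modnDr modnXm.
have cA : p.*2 <= residue_count (p ^ 2) A.
  rewrite -mulnn [residue_count _ _]count_periods // -muln2 leq_mul2l eqn0Ngt p0 /=.
  rewrite /residue_count -size_filter.
  apply: (@uniq_leq_size _ [:: 1; p - 1]).
    by rewrite /= inE andbT neq_ltn; apply/orP; left; lia.
  move=> z; rewrite mem_filter mem_iota add0n !inE => /orP[]/eqP->.
    by rewrite /A exp1n eqxx.
  rewrite /A ltn_subrL p0 andbT.
  by rewrite sqrn_pred // modnMDl eqxx.
have cB : residue_count (p ^ 2) B <= 2.
  apply: (@residue_count_le2 _ _ 1 (p ^ 2 - 1)) => -[|z] zp.
    by rewrite /B !modn_small // ?expn_gt0 ?p0 // -[1](exp1n 2) ltn_exp2r.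
  rewrite /B eq_sym eqn_mod_dvd ?expn_gt0 // -[X in _ - X](exp1n 2) subn_sqr.
  rewrite subn1 addn1 /= => dv.
  (* The residue is [z.+1], so [p ^ 2] divides z (z + 2). As [p] is odd it divides at most one of
     the two factors, and that factor absorbs all of [p ^ 2]. *)
  have [pz|npz] := boolP (p %| z).
    left; move: dv; rewrite Gauss_dvdl.
      case: z zp pz => [//|z] zp _ /dvdn_leq => /(_ isT); rewrite leqNgt.
      by rewrite (ltnW zp).
    rewrite coprimeXl // prime_coprime //; apply/negP => pz2.
    by have := dvdn_sub pz2 pz; rewrite -addn2 addKn gtnNdvd.
  right; move: dv; rewrite Gauss_dvdr ?coprimeXl ?prime_coprime //.
  move=> /dvdn_leq -/(_ isT) le; apply/eqP.
  by rewrite -(eqn_add2r 1) subnK ?expn_gt0 ?p0 // addn1 eqn_leq zp le.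
have -> : residue_count (p ^ 2) (fun z => ~~ exactly_divides_diff p (z ^ 2) 1) =
    residue_count (p ^ 2) (predC (predD A B)).
  by apply: eq_count => z /=; rewrite /exactly_divides_diff -/(A z) -/(B z) andbC.
have := count_predC (predD A B) (iota 0 (p ^ 2)); rewrite size_iota.
rewrite -!/(residue_count _ _) residue_countD //.
move: (residue_count _ A) (residue_count _ B) (residue_count _ (predC _)) cA cB.
clear; lia.
Qed.

Local Open Scope ring_scope.

(** * Selberg's sieve *)

Lemma prodrD_subset (R : comNzRingType) (I : finType) (a b : I -> R) (S : {set I}) :
  \prod_(i in S) (a i + b i) =
  \sum_(T : {set I} | T \subset S) (\prod_(i in T) a i) * \prod_(i in S :\: T) b i.
Proof.
(* Extending [a] by 0 and [b] by 1 outside [S] makes every set not contained in [S] contribute 0, so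
   distributivity over the whole index type applies. *)
pose F i := if i \in S then a i else 0; pose G i := if i \in S then b i else 1.
rewrite (eq_bigr (fun i => F i + G i)); last by move=> i iS; rewrite /F /G iS.
rewrite big_mkcond /= (eq_bigr (fun i => F i + G i)); last first.
  by move=> i _; rewrite /F /G; case: (i \in S); rewrite ?add0r.
rewrite bigA_distr [RHS]big_mkcond /=; apply: eq_bigr => T _.
case: ifPn => [/subsetP TS|/subsetPn[i iT iS]]; last first.
  by rewrite (bigD1 i) //= iT /F (negPf iS) mul0r.
rewrite (bigID (mem T)) /=; congr (_ * _).
  by apply: eq_bigr => i iT; rewrite iT /F TS.
rewrite [RHS]big_mkcond [LHS]big_mkcond /=; apply: eq_bigr => i _.
by rewrite !inE /G; case: (i \in T).
Qed.

(** Möbius inversion on the lattice of subsets: expand the product over [r] of -1 + [i not in q],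
    whose factors are -1 on [q] and 0 outside. *)
Lemma alternating_sum_interval (R : comNzRingType) (I : finType) (q r : {set I}) :
  q \subset r ->
  \sum_(d : {set I} | (q \subset d) && (d \subset r)) (-1) ^+ #|d| =
  (-1) ^+ #|r| *+ (q == r) :> R.
Proof.
move=> qr.
have := prodrD_subset (fun=> -1) (fun i => (i \notin q)%:R : R) r.
rewrite (eq_bigr (fun d : {set I} => (-1) ^+ #|d| *+ (q \subset d))) => [|d dr]; last first.
  rewrite prodr_const; case: (boolP (q \subset d)) => [/subsetP qd|/subsetPn[i iq iNd]].
    rewrite big1 ?mulr1 // => i; rewrite !inE => /andP[iNd _].
    by rewrite (contraNN (qd i) iNd).
  by rewrite (bigD1 i) /= ?inE ?iNd ?(subsetP qr) // iq mul0r mulr0.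
under [X in _ = X]eq_bigr do rewrite mulrb.
rewrite -big_mkcondr /= => sumE.
under eq_bigl do rewrite andbC.
rewrite -sumE; have [->|neq] := eqVneq q r.
  rewrite -prodr_const; apply: eq_bigr => i ir; rewrite ir /= addr0 //.
have /properP[_ [i ir iq]] : q \proper r by rewrite properEneq neq.
by rewrite (bigD1 i) //= iq addNr mul0r.
Qed.

Section Selberg.
Variables (R : realFieldType) (I : finType) (g : I -> R) (D : {set {set I}}).
Hypothesis g_bounds : forall i, 0 < g i < 1.
Hypothesis D0 : set0 \in D.
Hypothesis D_sub : forall S T : {set I}, S \subset T -> T \in D -> S \in D.

Definition prod_on (f : I -> R) (S : {set I}) := \prod_(i in S) f i.
Definition odds (i : I) := g i / (1 - g i).
Definition selberg_sum := \sum_(S in D) prod_on odds S.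
(** Index sets stand for squarefree integers, with [(-1) ^+ #|d|] as Möbius function. These are
    Selberg's optimal weights: they minimize the quadratic form below among weights supported on [D]
    with value 1 at [set0]. *)
Definition selberg_weight (d : {set I}) :=
  (-1) ^+ #|d| / prod_on g d * (\sum_(r in D | d \subset r) prod_on odds r) / selberg_sum.

Lemma g_gt0 i : 0 < g i. Proof. by case/andP: (g_bounds i). Qed.
Lemma odds_gt0 i : 0 < odds i.
Proof. by have /andP[g0 g1] := g_bounds i; rewrite divr_gt0 // subr_gt0. Qed.
Lemma prod_on_gt0 f S : (forall i, 0 < f i) -> 0 < prod_on f S.
Proof. by move=> f0; apply: prodr_gt0. Qed.

Lemma selberg_sum_ge1 : 1 <= selberg_sum.
Proof.
rewrite /selberg_sum (bigD1 set0) //= /prod_on big_set0 lerDl sumr_ge0 // => S _.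
exact/ltW/prod_on_gt0/odds_gt0.
Qed.

Lemma selberg_sum_gt0 : 0 < selberg_sum.
Proof. exact: lt_le_trans ltr01 selberg_sum_ge1. Qed.

Lemma selberg_weight0 : selberg_weight set0 = 1.
Proof.
rewrite /selberg_weight cards0 /prod_on big_set0 expr0 divr1 mul1r.
rewrite (eq_bigl (mem D)) ?divff ?gt_eqF ?selberg_sum_gt0 // => S.
by rewrite sub0set andbT.
Qed.

Lemma selberg_weight_notin d : d \notin D -> selberg_weight d = 0.
Proof.
move=> dD; rewrite /selberg_weight big1 ?mulr0 ?mul0r // => r /andP[rD dr].
by rewrite (D_sub dr rD) in dD.
Qed.

(** The inner sum is a part of [selberg_sum], so their quotient is at most 1. The resulting loss is
    a power of the sieve level, which a long interval absorbs. *)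
Lemma selberg_weight_le d : `|selberg_weight d| <= (prod_on g d)^-1.
Proof.
have g0 := prod_on_gt0 d g_gt0; have L0 := selberg_sum_gt0.
rewrite /selberg_weight !normrM normrX normrN1 expr1n mul1r.
rewrite (gtr0_norm (_ : 0 < (prod_on g d)^-1)) ?invr_gt0 //.
rewrite (gtr0_norm (_ : 0 < selberg_sum^-1)) ?invr_gt0 //.
rewrite -mulrA; apply: ler_piMr; first by rewrite invr_ge0 ltW.
rewrite ler_pdivrMr // mul1r.
rewrite ger0_norm; last by apply: sumr_ge0 => r _; exact/ltW/prod_on_gt0/odds_gt0.
rewrite /selberg_sum [leRHS](bigID (fun r : {set I} => d \subset r)) /= lerDl.
by apply: sumr_ge0 => r _; exact/ltW/prod_on_gt0/odds_gt0.
Qed.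

(** Factor by factor, 1/g = 1 + 1/odds. *)
Lemma inv_prod_on_expand c :
  (prod_on g c)^-1 = \sum_(q : {set I} | q \subset c) (prod_on odds q)^-1.
Proof.
have := prodrD_subset (fun i => (odds i)^-1) (fun=> 1 : R) c.
rewrite (eq_bigr (fun i => (g i)^-1)) => [|i _]; last first.
  have /andP[g0 g1] := g_bounds i; rewrite /odds; field.
  by rewrite !gt_eqF //= subr_gt0.
rewrite prodfV => ->; apply: eq_bigr => q _.
by rewrite [X in _ * X]big1 ?mulr1 // prodfV.
Qed.

Lemma prod_onUI f S T :
  prod_on f (S :|: T) * prod_on f (S :&: T) = prod_on f S * prod_on f T.
Proof.
rewrite /prod_on (big_setID S) /= setUK setDUl setDv set0U.
by rewrite -mulrA [in RHS](big_setID (A := T) S) /= [T :&: S]setIC; congr (_ * _); rewrite mulrC.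
Qed.

(** After exchanging the sums, the alternating sum over the [d] between [q] and [r] vanishes unless
    [r = q]. *)
Lemma selberg_inversion (q : {set I}) :
  \sum_(d : {set I} | q \subset d) selberg_weight d * prod_on g d =
  (-1) ^+ #|q| * prod_on odds q *+ (q \in D) / selberg_sum.
Proof.
transitivity (\sum_(d : {set I} | q \subset d)
    \sum_(r in D | d \subset r) (-1) ^+ #|d| * prod_on odds r / selberg_sum).
  apply: eq_bigr => d _; rewrite -mulr_suml -mulr_sumr /selberg_weight.
  by field; rewrite !gt_eqF ?selberg_sum_gt0 // prod_on_gt0 // => i; exact: g_gt0.
rewrite (exchange_big_dep (fun r => (r \in D) && (q \subset r))) /=; last first.
  by move=> d r qd /andP[-> dr]; rewrite (subset_trans qd dr).
transitivity (\sum_(r in D | q \subset r)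
    ((-1) ^+ #|r| * prod_on odds r / selberg_sum) *+ (q == r)).
  apply: eq_bigr => r /andP[rD qr].
  rewrite -2!mulr_suml -!mulrnAl -alternating_sum_interval //.
  by congr (_ * _ * _); apply: eq_bigl => d; rewrite rD.
have [qD|qD] := boolP (q \in D).
  rewrite (bigD1 q) /=; last by rewrite qD subxx.
  rewrite eqxx big1 ?addr0 // => r /andP[_ /negPf rq].
  by rewrite eq_sym rq.
rewrite mul0r big1 // => r /andP[rD _].
by case: eqP => // qr; rewrite qr rD in qD.
Qed.

(* prod_on g (d :|: e) is the product over d times that over e, divided by that over
   d :&: e; expanding the last factor diagonalizes the form. *)
Lemma selberg_quadratic_form :
  \sum_(d : {set I}) \sum_(e : {set I})
    selberg_weight d * selberg_weight e * prod_on g (d :|: e) = selberg_sum^-1.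
Proof.
have L0 := selberg_sum_gt0.
transitivity (\sum_(d : {set I}) \sum_(e : {set I}) \sum_(q : {set I} | q \subset d :&: e)
   (selberg_weight d * prod_on g d) * (selberg_weight e * prod_on g e) / prod_on odds q).
  apply: eq_bigr => d _; apply: eq_bigr => e _.
  rewrite -mulr_sumr -inv_prod_on_expand.
  have := prod_onUI g d e; have := prod_on_gt0 (d :&: e) g_gt0.
  move: (prod_on g (_ :&: _)) (prod_on g (_ :|: _)) (prod_on g d) (prod_on g e).
  move=> u v x y u0 uv; have -> : v = x * y / u by rewrite -uv mulfK ?gt_eqF.
  rewrite [LHS]mulrA; congr (_ / _); exact: mulrACA.
transitivity (\sum_(q : {set I}) (prod_on odds q)^-1 *
   (\sum_(d : {set I} | q \subset d) selberg_weight d * prod_on g d) ^+ 2).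
  under eq_bigr do rewrite (exchange_big_dep xpredT) //=.
  rewrite exchange_big /=; apply: eq_bigr => q _.
  rewrite expr2 mulr_suml mulr_sumr [RHS]big_mkcond /=; apply: eq_bigr => d _.
  case: ifPn => qd; last by rewrite big1 // => e; rewrite subsetI (negPf qd).
  rewrite mulr_sumr mulr_sumr; apply: eq_big => [e|e _]; first by rewrite subsetI qd.
  by rewrite mulrC.
under eq_bigr do rewrite selberg_inversion.
rewrite (bigID (mem D)) /= [X in _ + X]big1 ?addr0 => [|q qD]; last first.
  by rewrite (negPf qD) mul0r expr0n mulr0.
transitivity (\sum_(q in D) prod_on odds q / selberg_sum ^+ 2).
  apply: eq_bigr => q qD; rewrite qD mulr1n.
  have o0 := prod_on_gt0 q odds_gt0.
  rewrite !exprMn sqrr_sign mul1r; field.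
  by rewrite !gt_eqF.
by rewrite -mulr_suml -/selberg_sum expr2 invfM mulrA divff ?gt_eqF // mul1r.
Qed.

(* Since the weight at the empty set is 1, the square of the total weight of the
   sets of events that occur at t dominates the indicator that none occurs. *)
Lemma selberg_upper_bound (T : Type) (s : seq T) (A : I -> pred T) (Y E : R) :
  (forall S : {set I}, (exists2 d, d \in D & exists2 e, e \in D & S = d :|: e) ->
     `|(count (fun t => [forall i in S, A i t]) s)%:R - Y * prod_on g S| <= E) ->
  (count (fun t => [forall i, ~~ A i t]) s)%:R <=
    Y / selberg_sum + E * (\sum_(d in D) `|selberg_weight d|) ^+ 2.
Proof.
move=> err.
pose w t := \sum_(d : {set I} | [forall i in d, A i t]) selberg_weight d.
have cE P : (count P s)%:R = \sum_(t <- s) (P t)%:R :> R.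
  by rewrite -sum1_count natr_sum big_mkcond; apply: eq_bigr => t _; case: (P t).
have -> : (count (fun t => [forall i, ~~ A i t]) s)%:R =
   \sum_(t <- s) [forall i, ~~ A i t]%:R :> R by rewrite cE.
apply: (@le_trans _ _ (\sum_(t <- s) w t ^+ 2)).
  apply: ler_sum => t _; case: (boolP [forall i, _]) => [/forallP noA|_]; last exact: sqr_ge0.
  rewrite /w (bigD1 set0) /=; last by apply/forall_inP => i; rewrite inE.
  rewrite selberg_weight0 big1 ?addr0 ?expr1n // => d /andP[/forall_inP dA /set0Pn[i id]].
  by have := noA i; rewrite dA.
have -> : \sum_(t <- s) w t ^+ 2 = \sum_(d : {set I}) \sum_(e : {set I})
   selberg_weight d * selberg_weight e * (count (fun t => [forall i in d :|: e, A i t]) s)%:R.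
  transitivity (\sum_(t <- s) \sum_(d : {set I}) \sum_(e : {set I})
     selberg_weight d * selberg_weight e * [forall i in d :|: e, A i t]%:R).
    apply: eq_bigr => t _; rewrite /w expr2 mulr_suml big_mkcond /=.
    apply: eq_bigr => d _; rewrite mulr_sumr.
    have eqU e : [forall i in d :|: e, A i t] = [forall i in d, A i t] && [forall i in e, A i t].
      apply/forall_inP/andP => [U|[/forall_inP Ad /forall_inP Ae] i].
        by split; apply/forall_inP => i id; apply: U; rewrite inE id ?orbT.
      by rewrite inE => /orP[/Ad|/Ae].
    case: ifPn => dA; last by rewrite big1 // => e _; rewrite eqU (negPf dA) mulr0.
    rewrite big_mkcond; apply: eq_bigr => e _; rewrite eqU dA.
    by case: ifP; rewrite ?mulr1 ?mulr0.
  rewrite exchange_big; apply: eq_bigr => d _; rewrite exchange_big; apply: eq_bigr => e _.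
  by rewrite cE mulr_sumr.
rewrite -selberg_quadratic_form mulr_sumr -lerBlDl -sumrB.
have -> : E * (\sum_(d in D) `|selberg_weight d|) ^+ 2 =
   \sum_(d in D) \sum_(e in D) E * (`|selberg_weight d| * `|selberg_weight e|).
  rewrite expr2 mulr_suml mulr_sumr; apply: eq_bigr => d _.
  by rewrite !mulr_sumr.
rewrite [leRHS]big_mkcond; apply: ler_sum => d _; rewrite mulr_sumr -sumrB.
case: ifPn => [dD|/selberg_weight_notin w0]; last first.
  by rewrite big1 // => e _; rewrite w0 !mul0r mulr0 subrr.
rewrite [leRHS]big_mkcond; apply: ler_sum => e _.
case: ifPn => [eD|/selberg_weight_notin w0]; last first.
  by rewrite w0 !(mulr0, mul0r) subrr.
rewrite [Y * _]mulrCA -mulrBr -normrM [leLHS]mulrC; apply: le_trans (ler_norm _) _.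
rewrite [leLHS]normrM; apply: ler_wpM2r => //; apply: err.
by exists d => //; exists e.
Qed.

End Selberg.

(** * Sums of reciprocals *)

Lemma ler_sum_inj (R : numDomainType) (T U : finType) (A : pred T) (B : pred U)
    (h : T -> U) (F : T -> R) (G : U -> R) :
  {in A &, injective h} -> {in A, forall x, B (h x)} ->
  (forall u, B u -> 0 <= G u) -> {in A, forall x, F x <= G (h x)} ->
  \sum_(x | A x) F x <= \sum_(u | B u) G u.
Proof.
move=> h_inj AB G0 FG.
apply: (@le_trans _ _ (\sum_(x in A) G (h x))); first exact: ler_sum.
rewrite -(big_imset G h_inj) [leRHS](bigID (mem [set h x | x in A])) /=.
rewrite (eq_bigl (fun u => B u && (u \in [set h x | x in A]))) => [|u].
  by rewrite lerDl; apply: sumr_ge0 => u /andP[/G0].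
by rewrite andbC; case: imsetP => // -[x xA ->]; rewrite AB.
Qed.

Section ReciprocalSums.
Variable R : realFieldType.

(* The index n = 0 is harmless: its term is 0^-1 = 0. *)
Definition recip_sum (P : pred nat) (N : nat) : R := \sum_(n < N.+1 | P n) n%:R^-1.

Lemma recip_sum_ge0 P N : 0 <= recip_sum P N.
Proof. by apply: sumr_ge0 => n _; rewrite invr_ge0 ler0n. Qed.

Lemma recip_sum_split (P P1 P2 : pred nat) (f g : nat -> nat) N :
  (forall n, (0 < n <= N)%N -> P n -> [/\ P1 (f n), P2 (g n) & (f n * g n)%N = n]) ->
  recip_sum P N <= recip_sum P1 N * recip_sum P2 N.
Proof.
move=> split; rewrite /recip_sum big_distrlr pair_big /=.
rewrite (bigID (fun n : 'I_N.+1 => (0 < n)%N)) /= [X in _ + X]big1 ?addr0; last first.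
  by move=> i /andP[_]; rewrite -eqn0Ngt => /eqP->; rewrite invr0.
have splitN (n : 'I_N.+1) : P n && (0 < n)%N -> [/\ P1 (f n), P2 (g n) & (f n * g n)%N = n].
  by move=> /andP[Pn n0]; apply: split => //; rewrite n0 -ltnS ltn_ord.
have fg_le (n : 'I_N.+1) : P n && (0 < n)%N -> (f n < N.+1)%N /\ (g n < N.+1)%N.
  move=> nA; have [_ _ e] := splitN _ nA; have /andP[_ n0] := nA.
  split; apply: leq_ltn_trans (ltn_ord n); apply: (dvdn_leq n0).
    by rewrite -[X in (_ %| X)%N]e dvdn_mulr.
  by rewrite -[X in (_ %| X)%N]e dvdn_mull.
pose h (n : 'I_N.+1) : 'I_N.+1 * 'I_N.+1 := (inord (f n), inord (g n)).
apply: (@ler_sum_inj _ _ _ (fun n : 'I_N.+1 => P n && (0 < n)%N) _ h).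
- move=> m n mA nA [/(congr1 val) /= ef /(congr1 val) /= eg].
  move: ef eg; have [? ?] := fg_le _ mA; have [? ?] := fg_le _ nA.
  rewrite !inordK // => ef eg; apply: val_inj => /=.
  by have [_ _ <-] := splitN m mA; have [_ _ <-] := splitN n nA; rewrite ef eg.
- move=> n nA; have [? ?] := fg_le _ nA; rewrite /= !inordK //.
  by have [-> ->] := splitN n nA.
- by move=> u _; rewrite mulr_ge0 ?invr_ge0 ?ler0n.
move=> n nA; have [? ?] := fg_le _ nA; rewrite /= !inordK //.
by have [_ _ e] := splitN n nA; rewrite -invfM -natrM e.
Qed.

(** Split [n] into its [rho]-part and the cofactor: a prime of the cofactor lies in [pi] but not in
    [rho], hence in [sigma]. *)
Lemma recip_sum_pnat_split (pi rho sigma : nat_pred) N :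
  (forall q, prime q -> (q <= N)%N -> q \in pi -> (q \in rho) || (q \in sigma)) ->
  recip_sum pi.-nat N <= recip_sum rho.-nat N * recip_sum sigma.-nat N.
Proof.
move=> sub; apply: (@recip_sum_split _ _ _ (fun n => n`_rho) (fun n => n`_rho^'))%N.
move=> n /andP[n0 nN] pin; split; rewrite ?partnC ?part_pnat //.
have part0 : (0 < n`_rho^')%N by rewrite part_gt0.
apply/(pnatP _ part0) => q qp qn.
have qn' : (q %| n)%N by apply: dvdn_trans qn (dvdn_part _ _).
have := sub q qp; rewrite (leq_trans (dvdn_leq n0 qn')) // => /(_ isT).
have -> : q \in pi by move/(pnatP _ n0): pin; apply.
move=> /(_ isT) /orP[qrho|//].
have := part_pnat rho^' n => /(pnatP _ part0) /(_ q qp qn).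
by rewrite inE /= qrho.
Qed.

Lemma sum_geometric_le (x : R) n : 0 <= x < 1 -> \sum_(i < n) x ^+ i <= (1 - x)^-1.
Proof.
move=> /andP[x0 x1]; have y0 : 0 < 1 - x by rewrite subr_gt0.
rewrite -[leLHS](mulfK (_ : 1 - x != 0)) ?gt_eqF //.
apply: ler_piMl; first by rewrite invr_ge0 ltW.
have := subrX1 x n; set s := \sum_(i < n) _ => e.
have -> : s * (1 - x) = 1 - x ^+ n by rewrite mulrC -[1 - x]opprB mulNr -e opprB.
by rewrite gerBl exprn_ge0.
Qed.

Lemma prime_inv_bounds p : prime p -> 0 <= (p%:R^-1 : R) < 1.
Proof.
move=> pp; rewrite invr_ge0 ler0n invf_lt1 ?ltr0n ?prime_gt0 //.
by rewrite ltr1n prime_gt1.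
Qed.

Lemma recip_sum_prime_powers p N : prime p ->
  recip_sum p.-nat N <= (1 - p%:R^-1)^-1.
Proof.
move=> pp; apply: le_trans (sum_geometric_le N.+1 (prime_inv_bounds pp)).
have log_lt (n : 'I_N.+1) : p.-nat n -> (logn p n < N.+1)%N.
  by move=> /andP[n0 _]; apply: leq_trans (ltn_logl _ n0) _; exact: ltnW.
have powE n : p.-nat n -> (p ^ logn p n = n)%N.
  by move=> /p_natP[k ->]; rewrite pfactorK.
apply: (@ler_sum_inj _ _ _ _ _ (fun n : 'I_N.+1 => inord (logn p n))).
- move=> m n pm pn /(congr1 val) /=; rewrite !inordK ?log_lt // => e.
  by apply: val_inj; rewrite /= -(powE _ pm) -(powE _ pn) e.
- by [].
- by move=> u _; apply: exprn_ge0; rewrite invr_ge0 ler0n.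
by move=> n pn; rewrite inordK ?log_lt // exprVn -natrX powE.
Qed.

Definition pred_of_seq (T : seq nat) : nat_pred := [pred q | q \in T].

Definition euler_factor (p : nat) : R := 1 - p%:R^-1.

Lemma recip_sum_le_euler (T : seq nat) N : all prime T ->
  recip_sum (pred_of_seq T).-nat N <= (\prod_(p <- T) euler_factor p)^-1.
Proof.
elim: T => [_|p T IH /= /andP[pp pT]].
  rewrite big_nil invr1 /recip_sum.
  apply: le_trans (_ : \sum_(i < 1) 1 <= 1); last by rewrite big_ord1.
  have pnat1 n : (pred_of_seq [::]).-nat n -> n = 1%N.
    move=> pn; have n0 : (0 < n)%N by case/andP: pn.
    apply/eqP; apply: contraT; rewrite neq_ltn ltnNge n0 /= => n1.
    by have /(pnatP _ n0) /(_ _ (pdiv_prime n1) (pdiv_dvd _)) := pn.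
  apply: (@ler_sum_inj _ _ _ _ _ (fun=> ord0)) => //.
    by move=> m n /pnat1 em /pnat1 en _; apply: val_inj; rewrite /= em en.
  by move=> n /pnat1 ->; rewrite invr1.
rewrite big_cons invfM.
apply: le_trans (_ : recip_sum p.-nat N * recip_sum (pred_of_seq T).-nat N <= _).
  by apply: recip_sum_pnat_split => q _ _; rewrite !inE.
apply: ler_pM; rewrite ?recip_sum_ge0 ?recip_sum_prime_powers ?IH //.
Qed.

Definition harmonic_sum (N : nat) : R := recip_sum predT N.

Lemma recip_sumS P N :
  recip_sum P N.+1 = recip_sum P N + (if P N.+1 then N.+1%:R^-1 else 0).
Proof. by rewrite /recip_sum big_mkcond big_ord_recr -big_mkcond. Qed.

Lemma harmonic_sumS N : harmonic_sum N.+1 = harmonic_sum N + N.+1%:R^-1.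
Proof. exact: recip_sumS. Qed.

(** Each dyadic block from 2^k + 1 to 2^(k+1) contributes between 1/2 and 1. Taking sieve levels to
    be powers of 2 lets [k] stand in for the logarithm. *)
Lemma harmonic_pow2 k : 1 + k%:R / 2 <= harmonic_sum (2 ^ k) <= 1 + k%:R.
Proof.
have block m n : (0 < m)%N ->
    n%:R / (m + n)%:R <= harmonic_sum (m + n) - harmonic_sum m <= n%:R / m%:R.
  move=> m0; rewrite /harmonic_sum /recip_sum.
  elim: n => [|n /andP[lo hi]]; first by rewrite addn0 subrr !mul0r lexx.
  rewrite addnS [X in X - _]recip_sumS /= addrAC -[n.+1]addn1 natrD !mulrDl !mul1r.
  apply/andP; split; apply: lerD => //.
  - apply: le_trans lo; apply: ler_wpM2l; first by rewrite ler0n.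
    by rewrite lef_pV2 ?posrE ?ltr0n ?addn_gt0 ?m0 // ler_nat leqnSn.
  - by rewrite lef_pV2 ?posrE ?ltr0n // ler_nat -addnS leq_addr.
elim: k => [|k /andP[lo hi]].
  by rewrite expn0 harmonic_sumS /harmonic_sum /recip_sum big_ord1 invr0 invr1 !addr0 add0r mul0r addr0 lexx.
have q0 : (0 < 2 ^ k)%N by rewrite expn_gt0.
have := block (2 ^ k)%N (2 ^ k)%N q0.
rewrite [in harmonic_sum (2 ^ k.+1)]expnS addnn -mul2n natrM invfM mulrCA divff ?mulr1 ?pnatr_eq0 -?lt0n //.
have kE : k.+1%:R = k%:R + 1 :> R by rewrite natr1.
by move=> /andP[lo' hi']; apply/andP; rewrite kE; split; lra.
Qed.

(** * The character mod 4 and its divisor sums *)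

Definition chi4 (n : nat) : R :=
  if (n %% 4 == 1)%N then 1 else if (n %% 4 == 3)%N then -1 else 0.

Lemma chi4M m n : chi4 (m * n)%N = chi4 m * chi4 n.
Proof.
rewrite /chi4 -modnMml -modnMmr.
have := ltn_pmod m (isT : 0 < 4)%N; have := ltn_pmod n (isT : 0 < 4)%N.
move: (m %% 4)%N (n %% 4)%N => [|[|[|[|//]]]] [|[|[|[|//]]]] _ _ //=;
  by rewrite ?(mulr0, mul0r, mulr1, mul1r, mulrNN).
Qed.

Lemma chi4X m k : chi4 (m ^ k)%N = chi4 m ^+ k.
Proof. by elim: k => [|k IH]; rewrite ?expn0 // expnS exprS chi4M IH. Qed.

Lemma chi4_cases n : [\/ chi4 n = 1, chi4 n = -1 | chi4 n = 0].
Proof. by rewrite /chi4; case: ifP => _; [exact: Or31|case: ifP => _; [exact: Or32|exact: Or33]]. Qed.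

Lemma mem_divisors_pfactorM p k m d : prime p -> (0 < m)%N -> ~~ (p %| m)%N ->
  reflect (exists2 i, (i <= k)%N & exists2 e, (e %| m)%N & d = (p ^ i * e)%N)
    (d %| p ^ k * m)%N.
Proof.
move=> pp m0 npm; have n0 : (0 < p ^ k * m)%N by rewrite muln_gt0 expn_gt0 prime_gt0.
apply: (iffP idP) => [dn|[i ik [e em ->]]]; last by rewrite dvdn_mul // dvdn_exp2l.
have d0 : (0 < d)%N := dvdn_gt0 n0 dn.
exists (logn p d).
  apply: leq_trans (dvdn_leq_log p n0 dn) _.
  by rewrite lognM // ?expn_gt0 ?(prime_gt0 pp) // pfactorK // (lognE p m) (negPf npm) !andbF addn0.
exists (d`_p^')%N; last by rewrite -p_part partnC.
have : (d`_p^' %| p ^ k * m)%N := dvdn_trans (dvdn_part _ _) dn.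
rewrite Gauss_dvdr // coprime_sym coprimeXl // prime_coprime //.
apply/negP => pd.
have part0 : (0 < d`_p^')%N by rewrite part_gt0.
by have /(pnatP _ part0) /(_ p pp pd) := part_pnat p^' d; rewrite !inE eqxx.
Qed.

(** For [n > 0] this is a quarter of the number of representations of [n] as a sum of two integer
    squares. *)
Definition chi4_divisor_sum n := \sum_(d <- divisors n) chi4 d.

Lemma divisors_pfactorM p k m : prime p -> (0 < m)%N -> ~~ (p %| m)%N ->
  perm_eq (divisors (p ^ k * m)) [seq (p ^ i * e)%N | i <- iota 0 k.+1, e <- divisors m].
Proof.
move=> pp m0 npm; have n0 : (0 < p ^ k * m)%N by rewrite muln_gt0 expn_gt0 prime_gt0.
have logE i e : e \in divisors m -> logn p (p ^ i * e) = i.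
  rewrite -dvdn_divisors // => em.
  have e0 := dvdn_gt0 m0 em.
  rewrite lognM // ?expn_gt0 ?(prime_gt0 pp) // pfactorK // (lognE p e).
  by rewrite (negPf (contra (fun pe => dvdn_trans pe em) npm)) !andbF addn0.
apply: uniq_perm; first exact: divisors_uniq.
  apply: allpairs_uniq; rewrite ?iota_uniq ?divisors_uniq // => u v us vs.
  have /allpairsP[[i e] /= [_ em ->]] := us; have /allpairsP[[j f] /= [_ fm ->]] := vs.
  move=> /= eq_if.
  have eij : i = j by rewrite -(logE i e em) eq_if logE.
  move: eq_if; rewrite eij => /eqP; rewrite eqn_pmul2l ?expn_gt0 ?prime_gt0 //.
  by move=> /eqP->.
move=> d; rewrite -dvdn_divisors //; apply/mem_divisors_pfactorM/allpairsP => //.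
  move=> [i ik [e em ->]]; exists (i, e).
  by rewrite mem_iota ltnS ik -dvdn_divisors.
move=> [[i e] []]; rewrite mem_iota ltnS /= -dvdn_divisors // => ik em ->.
by exists i => //; exists e.
Qed.

Lemma chi4_divisor_sum_pfactorM p k m : prime p -> (0 < m)%N -> ~~ (p %| m)%N ->
  chi4_divisor_sum (p ^ k * m) = (\sum_(i <- iota 0 k.+1) chi4 p ^+ i) * chi4_divisor_sum m.
Proof.
move=> pp m0 npm; rewrite /chi4_divisor_sum (perm_big _ (divisors_pfactorM k pp m0 npm)).
rewrite big_allpairs_dep mulr_suml; apply: eq_bigr => i _; rewrite mulr_sumr.
by apply: eq_bigr => e _; rewrite chi4M chi4X.
Qed.

Lemma alternating_geometric_ge0 k : 0 <= \sum_(i <- iota 0 k) (-1 : R) ^+ i.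
Proof.
have -> : \sum_(i <- iota 0 k) (-1 : R) ^+ i = (odd k)%:R; last by rewrite ler0n.
elim: k => [|k IH]; first by rewrite big_nil.
rewrite -addn1 iotaD big_cat IH big_seq1 add0n addn1 /= -signr_odd.
by case: (odd k); rewrite ?expr1 ?expr0 ?add0r ?subrr.
Qed.

(** Strong induction, removing the full power of the least prime [p]. Its factor is a sum of powers
    of [chi4 p]: all terms are nonnegative when [chi4 p] is 1 or 0, and the alternating sum is 0 or
    1 when it is -1. *)
Lemma chi4_divisor_sum_ge0 n : 0 <= chi4_divisor_sum n.
Proof.
have [N] := ubnP n; elim: N n => // N IH n nN.
have [n1|n1] := leqP n 1.
  (* At 0 the function [divisors] also returns [[:: 1]]. *)
  case: n n1 nN => [|[|//]] _ _;
    by rewrite /chi4_divisor_sum (_ : divisors _ = [:: 1%N]) // big_seq1 ler01.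
have pp := pdiv_prime n1; set p := pdiv n in pp *.
have [m cpm nE] := pfactor_coprime pp (ltnW n1).
have npm : ~~ (p %| m)%N by rewrite -prime_coprime.
have m0 : (0 < m)%N by rewrite lt0n; apply: contraNneq npm => ->; rewrite dvdn0.
have k0 : (0 < logn p n)%N by rewrite logn_gt0 mem_primes pp pdiv_dvd ltnW.
rewrite nE mulnC chi4_divisor_sum_pfactorM //; apply: mulr_ge0.
  case: (chi4_cases p) => ->; last first.
  - by rewrite -[_.+1]add1n iotaD big_cat big_seq1 expr0 addr_ge0 // sumr_ge0 // => i _; rewrite exprn_ge0.
  - exact: alternating_geometric_ge0.
  - by apply: sumr_ge0 => i _; rewrite exprn_ge0.
apply: IH; apply: leq_trans (_ : n <= N)%N; last by rewrite -ltnS.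
rewrite [in X in (_ < X)%N]nE ltn_Pmulr //.
by rewrite -[1%N](exp1n (logn p n)) ltn_exp2r // prime_gt1.
Qed.

Lemma chi4_partial_sum_le1 N : \sum_(e < N.+1) chi4 e / e%:R <= 1.
Proof.
have term e : chi4 e / e%:R <= e%:R^-1.
  have e0 : 0 <= (e%:R^-1 : R) by rewrite invr_ge0 ler0n.
  by case: (chi4_cases e) => ->; rewrite ?mul1r // ?mul0r // mulN1r ge0_cp.
pose A n := \sum_(e < n) chi4 e / e%:R.
have AS n : A n.+1 = A n + chi4 n / n%:R by rewrite /A big_ord_recr.
(* After a complete period the bound keeps a margin equal to the next positive term, which therefore
   cannot push the sum above 1. *)
have A4 m : A (4 * m).+1 <= 1 - (4 * m).+1%:R^-1.
  elim: m => [|m IH].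
    by rewrite /A muln0 big_ord1 mul0r invr1 subrr.
  have chiE j : chi4 (4 * m + j)%N = chi4 j by rewrite /chi4 mulnC modnMDl.
  have := chiE 1%N; have := chiE 2%N; have := chiE 3%N; have := chiE 4%N.
  rewrite !addnS !addn0 /chi4 /= -!/(chi4 _) => c4 c3 c2 c1.
  rewrite mulnS !addSn add0n !(AS _.+1) c1 c2 c3 c4.
  rewrite !mul0r !addr0 mul1r mulN1r.
  have arith (a x y z : R) : a <= 1 - x -> z <= y -> a + x - y <= 1 - z by lra.
  by apply: arith => //; rewrite lef_pV2 ?posrE ?ltr0n // ler_nat; lia.
have posr n : 0 <= (n%:R^-1 : R) by rewrite invr_ge0 ler0n.
rewrite -/(A _) [X in A X.+1](divn_eq N 4) mulnC.
set m := (N %/ 4)%N.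
have chiE j : chi4 (4 * m + j)%N = chi4 j by rewrite /chi4 mulnC modnMDl.
have := ltn_pmod N (isT : 0 < 4)%N; move: (N %% 4)%N => j.
have := chiE 1%N; have := chiE 2%N; have := chiE 3%N.
rewrite !addnS !addn0 /chi4 /= -!/(chi4 _) => c3 c2 c1.
move: (A4 m) (posr (4 * m).+1) (posr (4 * m).+3).
by case: j => [|[|[|[|//]]]]; rewrite ?addnS addn0 ?(AS _.+1) ?c1 ?c2 ?c3;
  rewrite ?mul0r ?addr0 ?mul1r ?mulN1r;
  move: (A _) (_.+1%:R^-1) (_.+3%:R^-1) => a x y ? ? ? _; lra.
Qed.

Lemma sum_divisors_ord n (F : nat -> R) : (0 < n)%N ->
  \sum_(d <- divisors n) F d = \sum_(d < n.+1 | (d %| n)%N) F d.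
Proof.
move=> n0; rewrite -(big_mkord (fun d => d %| n)%N F) /index_iota subn0.
rewrite -big_filter; apply: perm_big; apply: uniq_perm.
- exact: divisors_uniq.
- by rewrite filter_uniq // iota_uniq.
move=> d; rewrite mem_filter mem_iota add0n ltnS -dvdn_divisors //.
by case: (boolP (d %| n)%N) => // dn; rewrite (dvdn_leq n0 dn).
Qed.

(** Writing n = f d turns the left side into the sum over [f] of 1/f times a partial sum of
    chi4(d)/d up to N/f, which is at most 1. *)
Lemma sum_chi4_divisor_sum_le N :
  \sum_(n < N.+1 | (0 < n)%N) chi4_divisor_sum n / n%:R <= harmonic_sum N.
Proof.
have -> : \sum_(n < N.+1 | (0 < n)%N) chi4_divisor_sum n / n%:R =
    \sum_(n < N.+1 | (0 < n)%N) \sum_(d < N.+1 | (d %| n)%N) chi4 d / n%:R.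
  apply: eq_bigr => n n0; rewrite /chi4_divisor_sum sum_divisors_ord // mulr_suml.
  rewrite (big_ord_widen_cond N.+1 (fun d => d %| n)%N (fun d => chi4 d / n%:R)) //.
  apply: eq_bigl => d; case: (boolP (d %| n)%N) => // dn; rewrite /= ltnS dvdn_leq //.
rewrite pair_big_dep /=.
pose h (x : 'I_N.+1 * 'I_N.+1) : 'I_N.+1 * 'I_N.+1 := (inord (x.1 * x.2), x.2).
pose h' (x : 'I_N.+1 * 'I_N.+1) : 'I_N.+1 * 'I_N.+1 := (inord (x.1 %/ x.2), x.2).
rewrite (reindex_onto h h') /=; last first.
  move=> [n d] /= /andP[n0 dn]; rewrite /h /h' /= inordK ?divnK ?inord_val //.
  by rewrite (leq_ltn_trans (leq_div _ _)).
have -> : harmonic_sum N = \sum_(f < N.+1) f%:R^-1 * 1.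
  by rewrite /harmonic_sum /recip_sum; apply: eq_bigr => f _; rewrite mulr1.
apply: le_trans (_ : \sum_(f < N.+1) f%:R^-1 * \sum_(e < (N %/ f).+1) chi4 e / e%:R <= _); last first.
  apply: ler_sum => f _; apply: ler_wpM2l; first by rewrite invr_ge0 ler0n.
  exact: chi4_partial_sum_le1.
(* Out of range [inord] returns 0, so after reindexing the condition [0 < n] also enforces f d <=
   N. *)
have inord0 k : (N < k)%N -> inord k = ord0 :> 'I_N.+1.
  by move=> Nk; rewrite /inord /insubd insubN // ltnS -ltnNge.
rewrite (eq_bigl (fun x : 'I_N.+1 * 'I_N.+1 =>
    (0 < x.1)%N && ((0 < x.2)%N && (x.1 * x.2 <= N)%N))) => [|[f d] /=]; last first.
  have [fdN|fdN] := leqP (f * d) N; last by rewrite inord0 //= !andbF.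
  rewrite inordK // muln_gt0 dvdn_mull // andbT andbT -andbA; congr (_ && _).
  case: (posnP d) => [//|d0].
  by rewrite /h /h' /= inordK // mulnK // inord_val eqxx.
rewrite -(pair_big_dep (fun f : 'I_N.+1 => (0 < f)%N)
  (fun f d : 'I_N.+1 => (0 < d)%N && (f * d <= N)%N)
  (fun f d : 'I_N.+1 => chi4 d / (inord (f * d) : 'I_N.+1)%:R)) /=.
rewrite [leRHS](bigID (fun f : 'I_N.+1 => (0 < f)%N)) /= -[leLHS]addr0; apply: lerD.
  rewrite le_eqVlt; apply/orP; left; apply/eqP; apply: eq_bigr => f f0.
  rewrite mulr_sumr.
  rewrite (big_ord_widen_cond N.+1 xpredT (fun e => f%:R^-1 * (chi4 e / e%:R))) ?ltnS ?leq_div //.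
  rewrite [RHS](bigID (fun d : 'I_N.+1 => (0 < d)%N)) /= [X in _ + X]big1 ?addr0 => [|d]; last first.
    by rewrite -eqn0Ngt => /andP[_ /eqP->]; rewrite invr0 !mulr0.
  apply: eq_big => [d|d /andP[d0 fdN]].
    by rewrite andbC ltnS leq_divRL // mulnC.
  by rewrite inordK // natrM invfM mulrCA.
by rewrite big1 // => f; rewrite -eqn0Ngt => /eqP->; rewrite invr0 mul0r.
Qed.

Definition one_mod4 : nat_pred := [pred p | p %% 4 == 1]%N.

Lemma chi4_pnat_one_mod4 n : one_mod4.-nat n -> forall d, (d %| n)%N -> chi4 d = 1.
Proof.
move=> pn d dn; have pd := pnat_dvd dn pn.
have [N] := ubnP d; elim: N d pd {dn} => // N IH d pd dN.
have d0 : (0 < d)%N by case/andP: pd.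
have [d1|d1] := leqP d 1; first by have -> : d = 1%N by apply/eqP; rewrite eqn_leq d1.
have /dvdnP[e de] := pdiv_dvd d.
have /(pnatP _ d0) /(_ _ (pdiv_prime d1) (pdiv_dvd d)) := pd; rewrite inE => p1.
rewrite de chi4M {2}/chi4 p1 mulr1; apply: IH.
  by apply: pnat_dvd pd; rewrite de dvdn_mulr.
apply: leq_trans (_ : d <= N)%N; last by rewrite -ltnS.
rewrite [in X in (_ < X)%N]de ltn_Pmulr ?prime_gt1 ?pdiv_prime //.
by move: d0; rewrite {1}de muln_gt0 => /andP[].
Qed.

(** Expand the square and group the pairs by their product [n]. There are at most as many pairs as
    divisors of [n], all with [chi4] equal to 1, so [chi4_divisor_sum n] bounds their number; the
    other [n] contribute nonnegative terms. *)
Lemma recip_sum_one_mod4_sqr N : recip_sum one_mod4.-nat N ^+ 2 <= harmonic_sum (N * N).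
Proof.
apply: le_trans (sum_chi4_divisor_sum_le (N * N)).
rewrite expr2 /recip_sum big_distrlr pair_big /=.
pose h (x : 'I_N.+1 * 'I_N.+1) : 'I_(N * N).+1 := inord (x.1 * x.2).
have hE x : h x = (x.1 * x.2)%N :> nat.
  by rewrite inordK // ltnS leq_mul // -ltnS.
rewrite (partition_big h (fun n => 0 < n)%N) /=; last first.
  by move=> [a b] /= /andP[/andP[a0 _] /andP[b0 _]]; rewrite hE muln_gt0 a0.
apply: ler_sum => n n0.
have [[a b] /andP[/andP[/= pa pb] /eqP hn]|noab] :=
  pickP (fun x : 'I_N.+1 * 'I_N.+1 => one_mod4.-nat x.1 && one_mod4.-nat x.2 && (h x == n)); last first.
  rewrite big_pred0 //; apply: mulr_ge0; last by rewrite invr_ge0 ler0n.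
  exact: chi4_divisor_sum_ge0.
have pn : one_mod4.-nat n by rewrite -hn hE pnatM /= pa.
rewrite /chi4_divisor_sum sum_divisors_ord // mulr_suml.
pose k (x : 'I_N.+1 * 'I_N.+1) : 'I_n.+1 := inord x.1.
have kE x : h x == n -> k x = x.1 :> nat.
  move=> /eqP hx; rewrite inordK // ltnS dvdn_leq // -hx hE.
  exact: dvdn_mulr.
apply: (@ler_sum_inj _ _ _ _ _ k).
- move=> [x y] [x' y'] /andP[_ hx] /andP[_ hx'] /(congr1 val) /=.
  rewrite !kE //= => xx'; have {xx'} xx' : x = x' by apply: val_inj.
  move: (eqP hx) => /(congr1 val) /=; rewrite -(eqP hx') !hE /= xx' => /eqP.
  have : (0 < x')%N by move: n0; rewrite -(eqP hx') hE muln_gt0 => /andP[].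
  by move=> x0; rewrite eqn_pmul2l // => /eqP yy'; congr (_, _); apply: val_inj.
- by move=> x /andP[_ hx]; rewrite kE // -(eqP hx) hE dvdn_mulr.
- by move=> d dn; rewrite (chi4_pnat_one_mod4 pn dn) mul1r invr_ge0 ler0n.
move=> x /andP[_ hx]; rewrite (chi4_pnat_one_mod4 pn) ?mul1r; last first.
  by rewrite kE // -(eqP hx) hE dvdn_mulr.
by rewrite -invfM -natrM -hE (eqP hx).
Qed.

End ReciprocalSums.

(** * Lower bound for the sieve sum *)

Lemma prod_coprime_dvdn (I : eqType) (s : seq I) (m : I -> nat) n : uniq s ->
  (forall i j, i \in s -> j \in s -> i != j -> coprime (m i) (m j)) ->
  (forall i, i \in s -> m i %| n)%N -> (\prod_(i <- s) m i %| n)%N.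
Proof.
elim: s => [|i s IH] /=; first by rewrite big_nil dvd1n.
move=> /andP[nis us] com dv; rewrite big_cons.
have sub j : j \in s -> j \in i :: s by rewrite inE orbC => ->.
rewrite Gauss_dvd; first by rewrite dv ?inE ?eqxx // IH // => [j k /sub ? /sub ?|j /sub ?]; auto.
rewrite big_seq; apply: (big_ind (fun x => coprime (m i) x)).
- exact: coprimen1.
- by move=> x y cx cy; rewrite coprimeMr cx.
- move=> j js; apply: com; rewrite ?inE ?eqxx ?js ?orbT //.
  by apply: contraNneq nis => ->.
Qed.

Section PrimeFamily.
Variables (R : realFieldType) (I : finType) (p : I -> nat).
Hypothesis p_inj : injective p.
Hypothesis p_prime : forall i, prime (p i).

Definition prime_prod (S : {set I}) := (\prod_(i in S) p i)%N.

Lemma p_coprime i j : i != j -> coprime (p i) (p j).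
Proof.
move=> ij; rewrite prime_coprime // dvdn_prime2 //.
by apply: contra ij => /eqP /p_inj ->.
Qed.

Lemma prime_prod_gt0 S : (0 < prime_prod S)%N.
Proof. by apply: prodn_gt0 => i; rewrite prime_gt0. Qed.

Lemma prime_prod_dvdn (S : {set I}) n : (forall i, i \in S -> p i %| n)%N -> (prime_prod S %| n)%N.
Proof.
move=> dv; rewrite /prime_prod -big_enum /=; apply: prod_coprime_dvdn.
- exact: enum_uniq.
- by move=> i j _ _; apply: p_coprime.
- by move=> i; rewrite mem_enum; apply: dv.
Qed.

Lemma dvdn_prime_prod (S : {set I}) i : (p i %| prime_prod S)%N = (i \in S).
Proof.
rewrite /prime_prod Euclid_dvd_prod // big_has_cond.
apply/hasP/idP => [[j _ /andP[jS]]|iS]; last first.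
  by exists i; rewrite ?mem_index_enum /= ?iS ?dvdnn.
by rewrite dvdn_prime2 // => /eqP /p_inj ->.
Qed.

Lemma prime_prod_inj : injective prime_prod.
Proof. by move=> S T e; apply/setP => i; rewrite -!dvdn_prime_prod e. Qed.

Lemma prime_prodU (S T : {set I}) : (prime_prod (S :|: T) <= prime_prod S * prime_prod T)%N.
Proof.
apply: dvdn_leq; first by rewrite muln_gt0 !prime_prod_gt0.
apply: prime_prod_dvdn => i; rewrite inE => /orP[] iS.
  by rewrite dvdn_mulr // dvdn_prime_prod.
by rewrite dvdn_mull // dvdn_prime_prod.
Qed.

Lemma prime_prodS (S T : {set I}) : S \subset T -> (prime_prod S <= prime_prod T)%N.
Proof.
move=> /subsetP ST; apply: dvdn_leq; first exact: prime_prod_gt0.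
by apply: prime_prod_dvdn => i /ST; rewrite dvdn_prime_prod.
Qed.

(** Through [prime_prod], these sets encode the squarefree integers up to [Q] composed of primes of
    the family. *)
Definition smooth_sets (Q : nat) := [set S : {set I} | (prime_prod S <= Q)%N].

(** Sort the integers by the set [S] of primes dividing them. Those with support [S] are
    [prime_prod S] times an integer composed of the same primes, and (1/p) / (1 - 1/p) = 1/(p -
    1). *)
Lemma recip_sum_le_squarefree (pi : nat_pred) Q :
  (forall q, prime q -> (q <= Q)%N -> q \in pi -> exists i, p i = q) ->
  recip_sum R pi.-nat Q <= \sum_(S in smooth_sets Q) \prod_(i in S) ((p i)%:R - 1)^-1.
Proof.
move=> piI; pose supp (n : 'I_Q.+1) := [set i | (p i %| n)%N].
have dvdS (n : 'I_Q.+1) : (prime_prod (supp n) %| n)%N.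
  by apply: prime_prod_dvdn => i; rewrite inE.
rewrite /recip_sum (partition_big supp (mem (smooth_sets Q))) /=; last first.
  move=> n /andP[n0 _]; rewrite inE; apply: leq_trans (dvdn_leq n0 (dvdS n)) _.
  by rewrite -ltnS.
apply: ler_sum => S _; pose T := [seq p i | i <- enum S].
have Tprime : all prime T by apply/allP => q /mapP[i _ ->].
have PS0 : (prime_prod S)%:R != 0 :> R by rewrite pnatr_eq0 -lt0n prime_prod_gt0.
apply: (@le_trans _ _ ((prime_prod S)%:R^-1 * recip_sum R (pred_of_seq T).-nat Q)); last first.
  apply: le_trans (_ : (prime_prod S)%:R^-1 * (\prod_(q <- T) euler_factor R q)^-1 <= _).
    by apply: ler_wpM2l; rewrite ?invr_ge0 ?ler0n // recip_sum_le_euler.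
  rewrite big_map big_enum /= -invfM natr_prod -big_split /= -prodfV.
  rewrite le_eqVlt; apply/orP; left; apply/eqP; apply: eq_bigr => i _; congr (_^-1).
  by rewrite /euler_factor mulrBr mulr1 divff // pnatr_eq0 -lt0n prime_gt0.
rewrite /recip_sum mulr_sumr.
pose h (n : 'I_Q.+1) : 'I_Q.+1 := inord (n %/ prime_prod S).
have hE n : h n = (n %/ prime_prod S)%N :> nat.
  by rewrite inordK // (leq_ltn_trans (leq_div _ _)).
have hM n : supp n == S -> (h n * prime_prod S)%N = n.
  by move=> /eqP sS; rewrite hE divnK // -sS.
apply: (@ler_sum_inj _ _ _ _ _ h).
- move=> m n /andP[_ sm] /andP[_ sn] /(congr1 val) /= e.
  by apply: val_inj; rewrite /= -(hM m) // -(hM n) // e.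
- move=> n /andP[pn sn]; have n0 : (0 < n)%N by case/andP: pn.
  have hn0 : (0 < h n)%N by move: n0; rewrite -(hM n sn) muln_gt0 => /andP[].
  apply/(pnatP _ hn0) => q qp qh.
  have qn : (q %| n)%N by rewrite -(hM n sn) dvdn_mulr.
  have qQ : (q <= Q)%N by apply: leq_trans (dvdn_leq n0 qn) _; rewrite -ltnS.
  have qpi : q \in pi by move/(pnatP _ n0): pn; apply.
  have [i iq] := piI q qp qQ qpi; rewrite inE -iq; apply: map_f.
  by rewrite mem_enum -(eqP sn) inE iq.
- by move=> n _; rewrite mulr_ge0 // invr_ge0 ler0n.
by move=> n /andP[_ sn]; rewrite -invfM -natrM mulnC hM.
Qed.

End PrimeFamily.

Lemma prod_inv_sqr_le3 (R : realFieldType) n :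
  \prod_(3 <= m < n) (1 + 2 / m%:R ^+ 2) <= 3 :> R.
Proof.
case: (leqP n 3) => n3; first by rewrite big_geq // ler1n.
(* The factor 1 - 2/(k + 3) makes the induction close; it is 1/3 at [k = 0], whence the constant
   3. *)
suff : forall k, \prod_(3 <= m < k + 3) (1 + 2 / m%:R ^+ 2) <= 3 * (1 - 2 / (k + 3)%:R) :> R.
  move=> /(_ (n - 3)%N); rewrite subnK 1?ltnW // => le; apply: le_trans le _.
  by rewrite ger_pMr // gerBl divr_ge0 ?ler0n.
elim=> [|k IH]; first by rewrite add0n big_geq //; lra.
rewrite addSn big_nat_recr ?leq_addl //=.
have x0 : (0 : R) < (k + 3)%:R by rewrite ltr0n addn3.
have xk : (3 : R) <= (k + 3)%:R by rewrite ler_nat leq_addl.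
apply: le_trans (_ : 3 * (1 - 2 / (k + 3)%:R) * (1 + 2 / (k + 3)%:R ^+ 2) <= _).
  by apply: ler_wpM2r; [apply: addr_ge0; rewrite ?divr_ge0 // exprn_ge0 // ltW | exact: IH].
have -> : (k + 3).+1%:R = (k + 3)%:R + 1 :> R by rewrite natr1.
move: (k + 3)%:R x0 xk => x x0 xk.
rewrite -mulrA; apply: ler_wpM2l => //.
rewrite -subr_ge0.
have -> : 1 - 2 / (x + 1) - (1 - 2 / x) * (1 + 2 / x ^+ 2) = (2 * x + 4) / (x ^+ 3 * (x + 1)).
  by field; rewrite !gt_eqF //; lra.
by rewrite divr_ge0 // ?mulr_ge0 ?exprn_ge0 //; lra.
Qed.

Section OddPrimeFamily.
Variables (R : realFieldType) (I : finType) (p : I -> nat).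
Hypothesis p_inj : injective p.
Hypothesis p_prime : forall i, prime (p i).
Hypothesis p_ge3 : forall i, (3 <= p i)%N.

(* The density of the integers that p_i divides exactly once. *)
Definition once_density (i : I) : R := ((p i)%:R - 1) / (p i)%:R ^+ 2.

Let p_ge3R i : 3 <= (p i)%:R :> R. Proof. by rewrite ler_nat. Qed.

Lemma once_density_bounds i : 0 < once_density i < 1.
Proof.
have x3 := p_ge3R i; rewrite /once_density; move: (p i)%:R x3 => x x3.
rewrite divr_gt0 ?exprn_gt0 //; try lra.
by rewrite ltr_pdivrMr ?exprn_gt0 ?mul1r; nra.
Qed.

(** The sieve sum carries (p - 1)/(p^2 - p + 1) where the Euler product gives 1/(p - 1). The
    difference is of order 1/p^2, so replacing one by the other costs only a bounded factor. *)
Let excess i : R := ((p i)%:R - 1)^-1 - odds once_density i.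

Let excess_bounds i : 0 <= excess i <= 2 / (p i)%:R ^+ 2.
Proof.
have x3 := p_ge3R i; rewrite /excess /odds /once_density; move: (p i)%:R x3 => x x3.
have x0 : 0 < x by lra.
have y0 : 0 < x - 1 by lra.
have z0 : 0 < x ^+ 2 - x + 1 by nra.
have -> : (x - 1)^-1 - (x - 1) / x ^+ 2 / (1 - (x - 1) / x ^+ 2) = x / ((x - 1) * (x ^+ 2 - x + 1)).
  field; rewrite !gt_eqF //=; nra.
have d0 := mulr_gt0 y0 z0; apply/andP; split; first by rewrite ltW // divr_gt0.
rewrite ler_pdivrMr ?mulr_gt0 // mulrAC ler_pdivlMr ?exprn_gt0 //.
rewrite -subr_ge0.
have -> : 2 * ((x - 1) * (x ^+ 2 - x + 1)) - x * x ^+ 2 = x * (x - 2) ^+ 2 - 2 by ring.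
have : 1 <= (x - 2) ^+ 2 by rewrite expr2; nra.
nra.
Qed.

(** The [p i] are distinct integers at least 3, so the product over all such integers dominates. *)
Lemma prod_excess_le3 : \prod_i (1 + excess i) <= 3.
Proof.
pose f m : R := 1 + 2 / m%:R ^+ 2.
have f1 m : 1 <= f m by rewrite /f lerDl divr_ge0 // exprn_ge0 // ler0n.
apply: le_trans (_ : \prod_i f (p i) <= _).
  apply: ler_prod => i _; have /andP[e0 e1] := excess_bounds i.
  by rewrite addr_ge0 // lerD2l.
pose n := (\max_i p i).+1.
apply: le_trans (prod_inv_sqr_le3 R n).
have -> : \prod_i f (p i) = \prod_(m <- [seq p i | i <- enum I]) f m.
  by rewrite big_map big_enum.
have -> : \prod_(m <- [seq p i | i <- enum I]) f m =
    \prod_(m <- index_iota 3 n | m \in [seq p i | i <- enum I]) f m.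
  rewrite -[RHS]big_filter; apply: perm_big; apply: uniq_perm.
  - by rewrite map_inj_uniq // enum_uniq.
  - by rewrite filter_uniq // iota_uniq.
  move=> m; rewrite mem_filter; case: (boolP (m \in map _ _)) => //= /mapP[i _ ->].
  by rewrite mem_index_iota p_ge3 ltnS leq_bigmax.
rewrite [leRHS](bigID (fun m => m \in [seq p i | i <- enum I])) /=.
have P0 (P : pred nat) : 0 <= \prod_(3 <= m < n | P m) f m.
  by apply: prodr_ge0 => m _; apply: le_trans (f1 m).
rewrite ler_peMr //.
apply: (big_ind (fun x => 1 <= x)) => [//|x y x1 y1|m _]; last exact: f1.
by rewrite -[1]mulr1; apply: ler_pM.
Qed.

(** Expand each product of [odds] plus [excess] over the subsets [T] of [S]. For fixed [T], the sets
    [S :\: T] are distinct, so their excess products sum to at most the full product, hence to at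
    most 3. *)
Lemma sum_squarefree_le_selberg_sum Q :
  \sum_(S in smooth_sets p Q) \prod_(i in S) ((p i)%:R - 1)^-1 <=
  3 * selberg_sum once_density (smooth_sets p Q) :> R.
Proof.
have h0 S : 0 <= prod_on (odds once_density) S.
  exact/ltW/prod_on_gt0/odds_gt0/once_density_bounds.
have k0 S : 0 <= \prod_(i in S) excess i.
  by apply: prodr_ge0 => i _; have /andP[] := excess_bounds i.
apply: (@le_trans _ _ (\sum_(S in smooth_sets p Q) \sum_(T : {set I} | T \subset S)
     prod_on (odds once_density) T * \prod_(i in S :\: T) excess i)).
  rewrite le_eqVlt; apply/orP; left; apply/eqP; apply: eq_bigr => S _.
  rewrite -prodrD_subset; apply: eq_bigr => i _.
  by rewrite /excess subrKC.
rewrite (exchange_big_dep (mem (smooth_sets p Q))) /=; last first.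
  move=> S T; rewrite !inE => SQ TS; exact: leq_trans (prime_prodS p_inj p_prime TS) SQ.
rewrite /selberg_sum mulrC mulr_suml; apply: ler_sum => T _.
rewrite -mulr_sumr; apply: ler_wpM2l => //.
apply: le_trans prod_excess_le3.
have -> : \prod_i (1 + excess i) = \sum_(U : {set I}) \prod_(i in U) excess i.
  transitivity (\prod_(i in [set: I]) (excess i + 1)).
    by apply: eq_big => [i|i _]; rewrite ?inE // addrC.
  rewrite prodrD_subset; apply: eq_big => [U|U _]; first exact: subsetT.
  by rewrite [X in _ * X]big1 ?mulr1.
apply: (@ler_sum_inj _ _ _ _ xpredT (fun S : {set I} => S :\: T)) => //.
move=> S S' /andP[_ TS] /andP[_ TS'] e.
by rewrite -(setID S T) -(setID S' T) e (setIidPr TS) (setIidPr TS').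
Qed.

(** Factor each integer up to [Q] into a power of 2, a part with primes 1 mod 4, a part with primes
    in [T] and a part in the family. The constant 6 is 2 for the powers of 2 times 3 for the
    excess. *)
Lemma harmonic_le_selberg_sum (T : seq nat) Q : all prime T ->
  (forall q, prime q -> (q <= Q)%N -> [|| q == 2%N, q %% 4 == 1, q \in T | [exists i, p i == q]])%N ->
  harmonic_sum R Q <= 6 * recip_sum R one_mod4.-nat Q *
    (\prod_(q <- T) euler_factor R q)^-1 * selberg_sum once_density (smooth_sets p Q).
Proof.
move=> pT covers.
pose rho : nat_pred := [pred q | [exists i, p i == q]].
pose r1 : nat_pred := [predU pred_of_seq T & rho].
pose r2 : nat_pred := [predU one_mod4 & r1].
have e0 := recip_sum_ge0 R.
have split1 : recip_sum R r1.-nat Q <=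
    recip_sum R (pred_of_seq T).-nat Q * recip_sum R rho.-nat Q.
  by apply: recip_sum_pnat_split => q _ _; rewrite !inE.
have split2 : recip_sum R r2.-nat Q <= recip_sum R one_mod4.-nat Q * recip_sum R r1.-nat Q.
  by apply: recip_sum_pnat_split => q _ _; rewrite !inE.
have pnatT n : (0 < n)%N -> (predT : nat_pred).-nat n by move=> n0; apply/pnatP.
have split3 : harmonic_sum R Q <= recip_sum R (pnat 2%N) Q * recip_sum R r2.-nat Q.
  apply: le_trans (_ : recip_sum R (predT : nat_pred).-nat Q <= _).
    rewrite /harmonic_sum /recip_sum [leRHS]big_mkcond; apply: ler_sum => n _.
    by case: ifPn => // /(contra (@pnatT _)); rewrite -eqn0Ngt => /eqP->; rewrite invr0.
  by apply: recip_sum_pnat_split => q qp qQ _; have := covers q qp qQ; rewrite !inE.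
have two : recip_sum R (pnat 2%N) Q <= 2.
  apply: le_trans (recip_sum_prime_powers R Q _) _ => //.
  by rewrite (_ : 1 - 2%:R^-1 = 2^-1) ?invrK //; lra.
have eulT := recip_sum_le_euler R Q pT.
have sq : recip_sum R rho.-nat Q <= 3 * selberg_sum once_density (smooth_sets p Q).
  apply: le_trans (sum_squarefree_le_selberg_sum Q); apply: recip_sum_le_squarefree => //.
  by move=> q _ _; rewrite inE => /existsP[i /eqP]; exists i.
apply: le_trans split3 _.
apply: le_trans (_ : 2 * (recip_sum R one_mod4.-nat Q *
  ((\prod_(q <- T) euler_factor R q)^-1 * (3 * selberg_sum once_density (smooth_sets p Q)))) <= _); last first.
  by rewrite le_eqVlt; apply/orP; left; apply/eqP; ring.
apply: ler_pM => //; apply: le_trans split2 _.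
apply: ler_wpM2l => //; apply: le_trans split1 _.
exact: ler_pM.
Qed.

End OddPrimeFamily.

(** * Euler products over the primes 3 mod 4 *)

Definition three_mod4 (p : nat) := prime p && (p %% 4 == 3)%N.

Lemma three_mod4_ge3 p : three_mod4 p -> (3 <= p)%N.
Proof. by case: p => [|[|[|p]]] // /andP[]. Qed.

Lemma prime_mod4 p : prime p -> [|| p == 2, p %% 4 == 1 | p %% 4 == 3]%N.
Proof.
move=> pp; case: (even_prime pp) => [-> //|oddp].
have := ltn_pmod p (isT : 0 < 4)%N.
have : odd (p %% 4) by move: oddp; rewrite {1}(divn_eq p 4) oddD oddM andbF.
by case: (p %% 4)%N => [|[|[|[|m]]]] //; rewrite ?orbT.
Qed.

Section Densities.
Variable R : realFieldType.

Definition euler_prod (T : seq nat) : R := \prod_(q <- T) euler_factor R q.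
Definition survivor_density (T : seq nat) : R :=
  \prod_(q <- T) (1 - 2 / q%:R + 2 / q%:R ^+ 2).

Lemma harmonic_pow2_gt0 k : 0 < harmonic_sum R (2 ^ k).
Proof.
have /andP[lo _] := harmonic_pow2 R k; apply: lt_le_trans lo.
by rewrite ltr_pwDl // divr_ge0 // ler0n.
Qed.

(** With Q = 2^k, this says that B / H(Q) is of order at most k^(-1/2): B^2 <= H(Q^2) <= 1 + 2k,
    whereas H(Q) >= 1 + k/2. *)
Lemma one_mod4_harmonic_ratio k :
  recip_sum R one_mod4.-nat (2 ^ k) ^+ 2 * (1 + k%:R / 2) ^+ 2 <=
  harmonic_sum R (2 ^ k) ^+ 2 * (1 + 2 * k%:R).
Proof.
have k0 : 0 <= k%:R :> R by rewrite ler0n.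
rewrite mulrC; apply: ler_pM; rewrite ?sqr_ge0 //.
  have /andP[lo _] := harmonic_pow2 R k.
  have x0 : 0 <= 1 + k%:R / 2 :> R by lra.
  by apply: lerXn2r; rewrite ?nnegrE // ltW // harmonic_pow2_gt0.
apply: le_trans (recip_sum_one_mod4_sqr R _) _.
have -> : (2 ^ k * 2 ^ k = 2 ^ (2 * k))%N by rewrite -expnD addnn mul2n.
by have /andP[_] := harmonic_pow2 R (2 * k); rewrite natrM.
Qed.

Lemma euler_factor_bounds q : (2 <= q)%N -> 0 < euler_factor R q <= 1.
Proof.
move=> q2; rewrite /euler_factor subr_gt0 gerBl invr_ge0 ler0n andbT.
by rewrite invf_lt1 ?ltr1n // ltr0n ltnW.
Qed.

Lemma euler_prod_gt0 T : all three_mod4 T -> 0 < euler_prod T.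
Proof.
move=> /allP T3; rewrite /euler_prod big_seq; apply: prodr_gt0 => q /T3 /three_mod4_ge3 q3.
by have /andP[] := euler_factor_bounds (ltnW q3).
Qed.

Definition three_mod4_upto n := [seq q <- iota 0 n.+1 | three_mod4 q].

(** With all primes 3 mod 4 up to 2^k put into [T], the previous inequalities give P <= 6 B / H. The
    constant is 144 = 36 * 4, from 1 + 2k <= 4 (1 + k/2). *)
Lemma euler_prod_sqr_le k : euler_prod (three_mod4_upto (2 ^ k)) ^+ 2 <= 144 / (1 + k%:R / 2).
Proof.
set T := three_mod4_upto _; have T3 : all three_mod4 T by apply: filter_all.
have E0 := euler_prod_gt0 T3.
have Tp : all prime T by apply: sub_all T3 => q /andP[].
(* With an empty family the sieve sum has only the term at [set0] and equals 1. *)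
pose p (i : void) : nat := match i with end.
have := @harmonic_le_selberg_sum R void p _ _ _ T (2 ^ k)%N Tp _.
have -> : selberg_sum (once_density R p) (smooth_sets p (2 ^ k)) = 1.
  rewrite /selberg_sum (bigD1 set0) /=; last by rewrite inE /prime_prod big_set0 expn_gt0.
  rewrite /prod_on big_set0 big1 ?addr0 // => S /andP[_ /set0Pn[[]]].
rewrite mulr1 -/(euler_prod T) => le.
have {}le : harmonic_sum R (2 ^ k) <= 6 * recip_sum R one_mod4.-nat (2 ^ k) * (euler_prod T)^-1.
  apply: le => [[]|[]|[]|q qp qQ].
  have /or3P[->|->|q3] := prime_mod4 qp; rewrite ?orbT //.
  by rewrite mem_filter mem_iota /three_mod4 qp q3 /= add0n ltnS qQ !orbT.
have H0 := harmonic_pow2_gt0 k; have B0 := recip_sum_ge0 R one_mod4.-nat (2 ^ k).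
have ratio := one_mod4_harmonic_ratio k.
have k0 : 0 <= k%:R :> R by rewrite ler0n.
move: (harmonic_sum _ _) (recip_sum _ _ _) (euler_prod T) (k%:R) le H0 B0 ratio E0 k0.
move=> H B E x le H0 B0 ratio E0 x0.
rewrite ler_pdivlMr // in le.
have sq : (H * E) ^+ 2 <= (6 * B) ^+ 2.
  by rewrite lerXn2r ?nnegrE // ?mulr_ge0 // ltW.
have u0 : 0 < 1 + x / 2 by lra.
rewrite ler_pdivlMr //.
rewrite -(ler_pM2l (_ : 0 < H ^+ 2 * (1 + x / 2))) ?mulr_gt0 ?exprn_gt0 //.
apply: le_trans (_ : (6 * B) ^+ 2 * (1 + x / 2) ^+ 2 <= _).
  rewrite exprMn in sq.
  have -> : H ^+ 2 * (1 + x / 2) * (E ^+ 2 * (1 + x / 2)) = H ^+ 2 * E ^+ 2 * (1 + x / 2) ^+ 2 by ring.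
  by apply: ler_wpM2r => //; apply: sqr_ge0.
rewrite exprMn -mulrA.
apply: le_trans (_ : 6 ^+ 2 * (H ^+ 2 * (1 + 2 * x)) <= _).
  by apply: ler_wpM2l => //; lra.
rewrite -subr_ge0.
have -> : H ^+ 2 * (1 + x / 2) * 144 - 6 ^+ 2 * (H ^+ 2 * (1 + 2 * x)) = 108 * H ^+ 2 by field.
by rewrite mulr_ge0 ?sqr_ge0.
Qed.

Lemma survivor_density_factor_bounds q : (3 <= q)%N ->
  0 < (1 - 2 / q%:R + 2 / q%:R ^+ 2 : R) <= 1.
Proof.
move=> q3; have x3 : 3 <= q%:R :> R by rewrite ler_nat.
have y0 : 0 < (q%:R^-1 : R) by rewrite invr_gt0; lra.
have y1 : q%:R^-1 <= 3^-1 :> R by rewrite lef_pV2 ?posrE //; lra.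
rewrite -exprVn; move: (q%:R^-1 : R) y0 y1 => y y0 y1.
by apply/andP; split; nra.
Qed.

(** For y = 1/q <= 1/3 each factor satisfies (1 - 2y + 2y^2)/(1 - y) <= 1 - y/2, and (1 - y/2)^3 <=
    1 - y. Thus D / P inherits decay from P. *)
Lemma survivor_density_ratio_le T : all three_mod4 T ->
  (survivor_density T / euler_prod T) ^+ 3 <= euler_prod T.
Proof.
move=> /allP T3; rewrite /survivor_density /euler_prod -prodfV -big_split /= -prodrXl.
rewrite big_seq [leRHS]big_seq; apply: ler_prod => q /T3 /three_mod4_ge3 q3.
have x3 : 3 <= q%:R :> R by rewrite ler_nat.
have y0 : 0 < (q%:R^-1 : R) by rewrite invr_gt0; lra.
have y1 : q%:R^-1 <= 3^-1 :> R by rewrite lef_pV2 ?posrE //; lra.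
have /andP[s0 _] := survivor_density_factor_bounds q3; move: s0.
rewrite /euler_factor -exprVn; move: (q%:R^-1 : R) y0 y1 => y y0 y1 s0.
have e0 : 0 < 1 - y by lra.
apply/andP; split; first by rewrite exprn_ge0 // divr_ge0 // ltW.
apply: le_trans (_ : (1 - y / 2) ^+ 3 <= _).
  apply: lerXn2r; rewrite ?nnegrE.
  - by rewrite divr_ge0 // ltW.
  - by lra.
  - by rewrite ler_pdivrMr //; nra.
have -> : (1 - y / 2) ^+ 3 = 1 - y - y * (1 / 2 - 3 / 4 * y + y ^+ 2 / 8) by field.
rewrite gerBl; apply: mulr_ge0; first exact: ltW.
by rewrite addr_ge0 ?divr_ge0 ?sqr_ge0 //; lra.
Qed.

Lemma exists_small_survivor_ratio (n : nat) : (0 < n)%N ->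
  exists T, [/\ uniq T, all three_mod4 T & survivor_density T / euler_prod T <= n%:R^-1].
Proof.
(* Sixth powers are compared: (D/P)^6 <= P^2 <= 144/(1 + k/2), and k/2 = 144 n^6. *)
move=> n0; pose k := (288 * n ^ 6)%N; exists (three_mod4_upto (2 ^ k)).
have T3 : all three_mod4 (three_mod4_upto (2 ^ k)) by apply: filter_all.
split=> //; first by rewrite filter_uniq // iota_uniq.
have E0 := euler_prod_gt0 T3.
have S0 : 0 <= survivor_density (three_mod4_upto (2 ^ k)).
  rewrite /survivor_density big_seq; apply: prodr_ge0 => q /(allP T3) /three_mod4_ge3 q3.
  by have /andP[/ltW] := survivor_density_factor_bounds q3.
have n0R : 0 < n%:R :> R by rewrite ltr0n.
have r0 : 0 <= survivor_density (three_mod4_upto (2 ^ k)) / euler_prod (three_mod4_upto (2 ^ k)).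
  by rewrite divr_ge0 // ltW.
rewrite -(@ler_pXn2r _ 6) ?nnegrE ?invr_ge0 ?ler0n //.
rewrite -[6%N]/(3 * 2)%N exprM.
apply: le_trans (_ : euler_prod (three_mod4_upto (2 ^ k)) ^+ 2 <= _).
  apply: lerXn2r; rewrite ?nnegrE ?exprn_ge0 //; first exact: ltW.
  exact: survivor_density_ratio_le.
apply: le_trans (euler_prod_sqr_le k) _.
rewrite exprVn natrM natrX; have : 0 < n%:R ^+ 6 :> R by rewrite exprn_gt0.
move: (n%:R ^+ 6) => x x0.
rewrite ler_pdivrMr; last by lra.
by rewrite ler_pdivlMl; [lra | exact: x0].
Qed.

End Densities.

(** * Sieving an interval *)

Lemma count_periodic_approx (R : realFieldType) W P a n : (0 < W)%N -> periodic W P ->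
  `|(count P (iota a n))%:R - n%:R * (residue_count W P)%:R / W%:R| <= (residue_count W P)%:R :> R.
Proof.
move=> W0 perP; have /andP[lo hi] := count_periodic_bounds a n W0 perP.
have W0R : 0 < W%:R :> R by rewrite ltr0n.
have qlo : (n %/ W)%:R <= n%:R / W%:R :> R.
  by rewrite ler_pdivlMr // -natrM ler_nat leq_trunc_div.
have qhi : n%:R / W%:R <= (n %/ W)%:R + 1 :> R.
  by rewrite ler_pdivrMr // natr1 -natrM ler_nat ltnW // ltn_ceil.
move: lo hi; rewrite -!(ler_nat R) !natrM -natr1 mulrAC => lo hi.
have c0 : 0 <= (residue_count W P)%:R :> R by rewrite ler0n.
move: (count _ _)%:R (residue_count W P)%:R (n%:R / W%:R) (n %/ W)%:R c0 lo hi qlo qhi.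
move=> x c y q c0 lo hi qlo qhi; rewrite ler_norml; apply/andP; split; nra.
Qed.

Section Survivors.
Variables (R : realFieldType) (T : seq nat).
Hypothesis T_uniq : uniq T.
Hypothesis T_three : all three_mod4 T.

(* For n = 1 mod q^2 a z outside this set has some q in T dividing n - z^2 exactly
   once, which rules out n = x^2 + y^2 + z^2. *)
Definition survivor (z : nat) := all (fun q => ~~ exactly_divides_diff q (z ^ 2) 1) T.
Definition square_modulus := (\prod_(q <- T) q ^ 2)%N.

Lemma T_prime q : q \in T -> prime q.
Proof. by move=> /(allP T_three) /andP[]. Qed.

Lemma square_modulus_gt0 : (0 < square_modulus)%N.
Proof.
by rewrite /square_modulus big_seq; apply: prodn_cond_gt0 => q /T_prime/prime_gt0; rewrite expn_gt0 => ->.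
Qed.

Lemma prime_coprime_sqr q q' : prime q -> prime q' -> q != q' -> coprime (q ^ 2) (q' ^ 2).
Proof.
by move=> pq pq' neq; rewrite coprimeXl // coprimeXr // prime_coprime // dvdn_prime2.
Qed.

(** The extra [square_modulus] accounts for the incomplete last period. *)
Lemma count_survivors_le Z :
  (count survivor (iota 0 Z.+1))%:R <= (Z.+1 + square_modulus)%:R * survivor_density R T.
Proof.
have [|||per dens] := @residue_count_all _ T (fun q => q ^ 2)%N
  (fun q z => ~~ exactly_divides_diff q (z ^ 2) 1) T_uniq.
- by move=> q /T_prime/prime_gt0; rewrite expn_gt0 => ->.
- by move=> q q' /T_prime pq /T_prime pq'; apply: prime_coprime_sqr.
- move=> q _ z; have sqE d : (d %| q ^ 2)%N -> ((z + q ^ 2) ^ 2 = z ^ 2 %[mod d])%N.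
    move=> dq; have e : (z + q ^ 2 = z %[mod d])%N by rewrite -modnDmr (eqP dq) addn0.
    by rewrite -(modnXm 2 d (z + q ^ 2)) e modnXm.
  by rewrite /exactly_divides_diff !sqE // dvdn_exp.
have W0 := square_modulus_gt0; have W0R : 0 < square_modulus%:R :> R by rewrite ltr0n.
have cle : (residue_count square_modulus survivor)%:R <= square_modulus%:R * survivor_density R T.
  rewrite [residue_count _ _]dens /square_modulus /survivor_density !natr_prod -big_split /=.
  rewrite big_seq [leRHS]big_seq; apply: ler_prod => q qT; rewrite ler0n /=.
  have qp := T_prime qT; have /three_mod4_ge3 q3 := allP T_three q qT.
  have oddq : odd q by case: (even_prime qp) q3 => [->|].
  have := residue_count_square_one qp oddq; rewrite -(ler_nat R) => le.
  apply: le_trans le _.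
  have q2 : (q.*2 <= q ^ 2)%N by rewrite -muln2 expnS expn1 leq_mul2l ltnW ?orbT.
  rewrite natrD natrB // -muln2 natrM natrX.
  have q0 : q%:R != 0 :> R by rewrite pnatr_eq0 -lt0n prime_gt0.
  by rewrite le_eqVlt; apply/orP; left; apply/eqP; field.
have := count_periodic_approx R 0 Z.+1 W0 per.
rewrite ler_norml -/survivor => /andP[_]; rewrite -/square_modulus lerBlDl => le.
apply: le_trans le _.
rewrite natrD mulrDl; apply: lerD; last exact: cle.
rewrite -mulrA; apply: ler_wpM2l; first by rewrite ler0n.
by rewrite ler_pdivrMr // mulrC.
Qed.

End Survivors.

Section IntervalSieve.
Variables (R : realFieldType) (I : finType) (p : I -> nat).
Hypothesis p_inj : injective p.
Hypothesis p_prime : forall i, prime (p i).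
Hypothesis p_ge3 : forall i, (3 <= p i)%N.
Variables (M b m Q : nat).
Hypothesis M_gt0 : (0 < M)%N.
Hypothesis M_coprime : forall i, coprime M (p i).
Hypothesis Q_gt0 : (0 < Q)%N.

Let D := smooth_sets p Q.

Lemma prod_on_once_density (S : {set I}) :
  prod_on (once_density R p) S = (\prod_(i in S) (p i - 1))%:R / (prime_prod p S)%:R ^+ 2.
Proof.
rewrite /prod_on /prime_prod !natr_prod -prodrXl -prodf_div.
by apply: eq_bigr => i _; rewrite /once_density natrB // prime_gt0.
Qed.

(** The period is [M] times the square of [prime_prod p S], but the error is only the number of
    admissible residues per period, the product of the [p i - 1]. *)
Lemma count_progression_once (S : {set I}) a N : 
  `|(count (fun n => (n == b %[mod M]) && [forall i in S, exactly_divides_diff (p i) m n])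
      (iota a N))%:R - N%:R / M%:R * prod_on (once_density R p) S| <= (prime_prod p S)%:R.
Proof.
have [||||per dens] := @residue_count_all _ (enum S) (fun i => p i ^ 2)%N
  (fun i n => exactly_divides_diff (p i) m n).
- exact: enum_uniq.
- by move=> i _; rewrite expn_gt0 prime_gt0.
- move=> i j _ _ ij; apply: prime_coprime_sqr => //.
  by apply: contra ij => /eqP /p_inj ->.
- by move=> i _; apply: periodic_exactly_divides_diff.
set W := (\prod_(i <- enum S) p i ^ 2)%N in per dens.
have WE : W = (prime_prod p S ^ 2)%N.
  by rewrite /W big_enum /= /prime_prod (big_morph (fun x => x ^ 2)%N (fun x y => expnMn x y 2) (exp1n 2)).
have W0 : (0 < W)%N by rewrite WE expn_gt0 prime_prod_gt0.
have cMW : coprime M W.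
  rewrite WE coprimeXr // /prime_prod; apply: (big_ind (fun x => coprime M x)) => //.
    exact: coprimen1.
  by move=> x y cx cy; rewrite coprimeMr cx.
have MW0 : (0 < M * W)%N by rewrite muln_gt0 M_gt0.
have dM := residue_countM cMW M_gt0 W0 (@periodic_eqmod M b) per.
rewrite residue_count_eqmod // mul1n dens in dM.
have perM : periodic (M * W) (predI (fun n => n == b %[mod M])
    (fun n => all (fun i => exactly_divides_diff (p i) m n) (enum S))).
  move=> n /=; rewrite (periodic_dvd (dvdn_mulr _ (dvdnn _)) (@periodic_eqmod M b)).
  by rewrite (periodic_dvd (dvdn_mull _ (dvdnn _)) per).
have := count_periodic_approx R a N MW0 perM; rewrite dM => approx.
have cE : (\prod_(i <- enum S) residue_count (p i ^ 2) [eta exactly_divides_diff (p i) m])%N =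
    (\prod_(i in S) (p i - 1))%N.
  rewrite big_enum /=; apply: eq_bigr => i _.
  by rewrite residue_count_exactly_divides_diff // prime_gt0.
rewrite cE in approx.
have -> : count (fun n => (n == b %[mod M]) && [forall i in S, exactly_divides_diff (p i) m n]) (iota a N) =
  count (predI (fun n => n == b %[mod M])
    (fun n => all (fun i => exactly_divides_diff (p i) m n) (enum S))) (iota a N).
  apply: eq_count => n /=; congr (_ && _); apply/forall_inP/allP => h i.
    by rewrite mem_enum; apply: h.
  by move=> iS; apply: h; rewrite mem_enum.
rewrite prod_on_once_density -natrX -WE.
have -> : N%:R / M%:R * ((\prod_(i in S) (p i - 1))%:R / W%:R) =
    N%:R * (\prod_(i in S) (p i - 1))%:R / (M * W)%:R :> R.
  by rewrite natrM invfM !mulrA; congr (_ / _); rewrite mulrAC.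
apply: le_trans approx _; rewrite ler_nat; apply: leq_prod => i _.
exact: leq_subr.
Qed.

Lemma card_smooth_sets : (#|D| <= Q)%N.
Proof.
rewrite cardE -(size_map (prime_prod p)) -(size_iota 1 Q); apply: uniq_leq_size.
  by rewrite map_inj_uniq ?enum_uniq //; apply: prime_prod_inj.
move=> n /mapP[S]; rewrite mem_enum inE => SQ ->.
by rewrite mem_iota prime_prod_gt0 // add1n ltnS.
Qed.

Lemma once_sieve a N :
  (count (fun n => (n == b %[mod M]) && [forall i, ~~ exactly_divides_diff (p i) m n])
      (iota a N))%:R <=
  N%:R / M%:R / selberg_sum (once_density R p) D + Q%:R ^+ 8.
Proof.
have gb := once_density_bounds R p_ge3.
have D0 : set0 \in D by rewrite inE /prime_prod big_set0.
have D_sub (S S' : {set I}) : S \subset S' -> S' \in D -> S \in D.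
  by rewrite !inE => SS'; apply: leq_trans; apply: prime_prodS.
set s := [seq n <- iota a N | n == b %[mod M]].
have := @selberg_upper_bound R I _ D gb D0 D_sub nat s
  (fun i n => exactly_divides_diff (p i) m n) (N%:R / M%:R) (Q%:R ^+ 2).
rewrite /s count_filter.
move=> bound; apply: le_trans (le_trans (bound _) _).
- rewrite le_eqVlt; apply/orP; left; apply/eqP; congr (_%:R).
  by apply: eq_count => n; rewrite /= andbC.
- move=> S [d dD [e eD ->]]; rewrite count_filter.
  have -> : count (predI (fun t => [forall i in d :|: e, exactly_divides_diff (p i) m t])
      (fun n => n == b %[mod M])) (iota a N) =
    count (fun n => (n == b %[mod M]) && [forall i in d :|: e, exactly_divides_diff (p i) m n])
      (iota a N) by apply: eq_count => n; rewrite /= andbC.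
  apply: le_trans (count_progression_once _ _ _) _.
  rewrite -natrX ler_nat; apply: leq_trans (prime_prodU p_inj p_prime d e) _.
  by move: dD eD; rewrite !inE => dQ eQ; rewrite expnS expn1 leq_mul.
rewrite lerD2l.
(* The error for a union of two sets of [D] is at most Q^2. The total weight is at most Q^3: at most
   [Q] sets, each of weight at most Q^2. *)
have -> : Q%:R ^+ 8 = Q%:R ^+ 2 * (Q%:R ^+ 3) ^+ 2 :> R by rewrite -exprM -exprD.
apply: ler_wpM2l; first by rewrite exprn_ge0.
apply: lerXn2r; rewrite ?nnegrE ?exprn_ge0 ?sumr_ge0 //.
apply: le_trans (_ : \sum_(d in D) Q%:R ^+ 2 <= _).
  apply: ler_sum => d; rewrite inE => dQ.
  apply: le_trans (selberg_weight_le gb D0 d) _.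
  rewrite prod_on_once_density invf_div.
  apply: le_trans (_ : (prime_prod p d)%:R ^+ 2 <= _); last first.
    by apply: lerXn2r; rewrite ?nnegrE ?ler0n // ler_nat.
  rewrite ler_pdivrMr.
    rewrite ler_peMr ?exprn_ge0 // ler1n; apply: prodn_gt0 => i.
    by rewrite subn_gt0 prime_gt1.
  by rewrite ltr0n; apply: prodn_gt0 => i; rewrite subn_gt0 prime_gt1.
rewrite sumr_const -[_ *+ #|D|]mulr_natl [leRHS]exprS; apply: ler_wpM2r; first by rewrite exprn_ge0.
by rewrite ler_nat card_smooth_sets.
Qed.

End IntervalSieve.

(** * The first moment *)

Definition representable (Z n : nat) :=
  [exists z : 'I_Z.+1, [exists x : 'I_n.+1, [exists y : 'I_n.+1,
    n == x ^ 2 + y ^ 2 + z ^ 2]]]%N.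

Lemma representableP Z n :
  reflect (exists z x y, (z <= Z)%N /\ n = (x ^ 2 + y ^ 2 + z ^ 2)%N) (representable Z n).
Proof.
apply: (iffP existsP) => [[z /existsP[x /existsP[y /eqP ->]]]|[z [x [y [zZ nE]]]]].
  by exists z, x, y; split=> //; rewrite -ltnS.
have le_sq (t : nat) : (t <= t ^ 2)%N by rewrite expnS expn1; case: t => // t; rewrite leq_pmulr.
have xn : (x < n.+1)%N by rewrite ltnS nE; apply: leq_trans (le_sq x) _; rewrite -addnA leq_addr.
have yn : (y < n.+1)%N.
  by rewrite ltnS nE; apply: leq_trans (le_sq y) _; rewrite addnAC leq_addl.
have zZ' : (z < Z.+1)%N by [].
exists (Ordinal zZ'); apply/existsP; exists (Ordinal xn); apply/existsP; exists (Ordinal yn).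
exact/eqP.
Qed.

Lemma sum_three_squares_not_once p x y z : three_mod4 p ->
  ~~ exactly_divides_diff p (z ^ 2) (x ^ 2 + y ^ 2 + z ^ 2).
Proof.
move=> /andP[pp /eqP p3].
have eqE d : ((x ^ 2 + y ^ 2 + z ^ 2 == z ^ 2 %[mod d]) = (d %| x ^ 2 + y ^ 2))%N.
  by rewrite -[X in _ == X %[mod d]]add0n eqn_modDr mod0n.
rewrite /exactly_divides_diff !eqE negb_and negbK -implybE.
by apply/implyP; exact: (sum_two_squares_even_val pp p3 (erefl _)).
Qed.

Lemma count_union_bound (J : finType) (T : Type) (P : pred T) (A : pred J) (F : J -> pred T) s :
  (forall t, P t -> exists2 j, A j & F j t) ->
  (count P s <= \sum_(j | A j) count (F j) s)%N.
Proof.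
move=> PF; elim: s => [|t s IH] //=.
rewrite big_split /= leq_add //.
case: (boolP (P t)) => //= /PF[j Aj Fj].
by rewrite (bigD1 j) //= Fj leq_addr.
Qed.

(** Here [y] is the expected size of the progression, [s] the number of surviving z, [u] = Z + 1 +
    W, [S] and [E] are D and P, and [q] is the sieve error Q^8. The main term contributes at most
    y/4 and the error at most y/8. *)
Lemma sieve_arithmetic (R : realFieldType) (y s u S E H B L k C2 q : R) :
  0 < y -> 0 <= u -> 0 <= S -> 0 < E -> 0 < H -> 0 <= B -> 0 < L -> 0 <= k -> 1 <= C2 -> 0 <= q ->
  s <= u * S -> S <= 1 -> H <= 6 * B * E^-1 * L -> S / E <= (4 * (17 * C2))^-1 ->
  B ^+ 2 * (1 + k / 2) ^+ 2 <= H ^+ 2 * (1 + 2 * k) -> u ^+ 2 <= C2 * k -> u * q <= y / 8 ->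
  s * (y / L + q) <= 3 / 8 * y.
Proof.
move=> y0 u0 S0 E0 H0 B0 L0 k0 C1 q0 sS S1 HL SE ratio uC uq.
have yL0 : 0 <= y / L by rewrite divr_ge0 // ltW.
apply: le_trans (_ : u * S * (y / L + q) <= _); first by apply: ler_wpM2r; rewrite ?addr_ge0.
rewrite mulrDr (_ : 3 / 8 * y = y / 4 + y / 8); last by field.
apply: lerD; last by apply: le_trans uq; rewrite mulrAC ler_piMr // mulr_ge0.
(* The constant 17 is chosen so that 36 k (1 + 2k) <= 17^2 (1 + k/2)^2; the leading coefficients are
   72 and 72.25. *)
have HB : 6 * u * B <= 17 * C2 * H.
  have k1 : 0 < 1 + k / 2 by lra.
  rewrite -(@ler_pXn2r _ 2) ?nnegrE ?mulr_ge0 //; try lra.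
  rewrite -(ler_pM2r (exprn_gt0 2 k1)).
  apply: le_trans (_ : 36 * (u ^+ 2 * (H ^+ 2 * (1 + 2 * k))) <= _).
    have -> : (6 * u * B) ^+ 2 * (1 + k / 2) ^+ 2 = 36 * (u ^+ 2 * (B ^+ 2 * (1 + k / 2) ^+ 2)) by ring.
    by apply: ler_wpM2l => //; apply: ler_wpM2l => //; apply: sqr_ge0.
  apply: le_trans (_ : 36 * (C2 * k * (H ^+ 2 * (1 + 2 * k))) <= _).
    apply: ler_wpM2l => //; apply: ler_wpM2r => //.
    by rewrite mulr_ge0 ?sqr_ge0 //; lra.
  have -> : 36 * (C2 * k * (H ^+ 2 * (1 + 2 * k))) = C2 * H ^+ 2 * (36 * k * (1 + 2 * k)) by ring.
  have -> : (17 * C2 * H) ^+ 2 * (1 + k / 2) ^+ 2 =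
    C2 * H ^+ 2 * (C2 * (289 * (1 + k / 2) ^+ 2)) by ring.
  apply: ler_wpM2l; first by rewrite mulr_ge0 ?sqr_ge0 //; lra.
  apply: le_trans (_ : 1 * (289 * (1 + k / 2) ^+ 2) <= _); last first.
    by apply: ler_wpM2r; [have := sqr_ge0 (1 + k / 2); lra | exact: C1].
  rewrite mul1r -subr_ge0.
  have -> : 289 * (1 + k / 2) ^+ 2 - 36 * k * (1 + 2 * k) = 289 + 253 * k + k ^+ 2 / 4 by field.
  by have := sqr_ge0 k; lra.
have invL : L^-1 <= 6 * B / (E * H).
  rewrite ler_pdivlMr ?mulr_gt0 // mulrC ler_pdivrMr //.
  rewrite -(ler_pM2l (_ : 0 < E^-1)) ?invr_gt0 // mulrA mulVf ?gt_eqF // mul1r.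
  by apply: le_trans HL _; rewrite le_eqVlt; apply/orP; left; apply/eqP; ring.
apply: le_trans (_ : u * S * (y * (6 * B / (E * H))) <= _).
  apply: ler_wpM2l; first by rewrite mulr_ge0.
  by apply: ler_wpM2l => //; apply: ltW.
have -> : u * S * (y * (6 * B / (E * H))) = y * (S / E * (6 * u * B / H)).
  by field; rewrite !gt_eqF.
apply: ler_wpM2l; first exact: ltW.
apply: le_trans (_ : (4 * (17 * C2))^-1 * (17 * C2) <= _).
  apply: ler_pM => //.
  - by rewrite divr_ge0 // ltW.
  - by rewrite divr_ge0 ?mulr_ge0 // ltW.
  - by rewrite ler_pdivrMr.
by rewrite invfM -mulrA mulVf ?mulr1 // gt_eqF //; lra.
Qed.

Lemma sqrn_le_pow2 k : (4 <= k)%N -> (k ^ 2 <= 2 ^ k)%N.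
Proof.
elim: k => // k IH; rewrite leq_eqVlt => /orP[/eqP <- //|].
rewrite ltnS => k4; rewrite (expnS 2); apply: leq_trans (_ : 2 * k ^ 2 <= _)%N.
  by rewrite !expnS !expn0; nia.
by rewrite leq_mul2l IH.
Qed.

Section Assembly.
Variable T : seq nat.
Hypothesis T_uniq : uniq T.
Hypothesis T_three : all three_mod4 T.
Let W := square_modulus T.
Let M := (8 * W)%N.
Variables (a k : nat).
Let Q := (2 ^ k)%N.
Let b := chinese 8 W a 1.
(** Excluding [T] itself, rather than all primes below a bound, ensures for any list [T] that [T]
    and the family cover the primes 3 mod 4 up to [Q]. *)
Definition sieve_index := {i : 'I_Q.+1 | three_mod4 i && (nat_of_ord i \notin T)}.
Definition sieve_prime (i : sieve_index) : nat := val (val i).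

Lemma sieve_prime_inj : injective sieve_prime.
Proof. by move=> i j e; apply/val_inj/val_inj. Qed.

Lemma sieve_prime_three i : three_mod4 (sieve_prime i).
Proof. by have /andP[] := valP i. Qed.

Lemma sieve_prime_notin i : sieve_prime i \notin T.
Proof. by have /andP[] := valP i. Qed.

Lemma coprime_square_modulus q : prime q -> q \notin T -> coprime W q.
Proof.
move=> pq qT; rewrite /W /square_modulus big_seq coprime_sym.
apply: (big_ind (fun x => coprime q x)) => [|x y cx cy|r rT]; first exact: coprimen1.
  by rewrite coprimeMr cx.
rewrite coprimeXr // prime_coprime // dvdn_prime2 // ?(T_prime T_three) //.
by apply: contraNneq qT => ->.
Qed.

Lemma coprime8W : coprime 8 W.
Proof.
have -> : 8%N = (2 ^ 3)%N by [].
rewrite coprimeXl // coprime_sym; apply: coprime_square_modulus => //.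
by apply: contraT; rewrite negbK => /(allP T_three).
Qed.

Lemma modulus_coprime i : coprime M (sieve_prime i).
Proof.
have /andP[pp /eqP p3] := sieve_prime_three i.
rewrite coprimeMl (coprime_square_modulus pp (sieve_prime_notin i)) andbT.
have -> : 8%N = (2 ^ 3)%N by [].
rewrite coprimeXl // prime_coprime // dvdn_prime2 //.
by apply/eqP => e; rewrite -e in p3.
Qed.

Let W_gt0 : (0 < W)%N := square_modulus_gt0 T_three.
Let M_gt0 : (0 < M)%N. Proof. by rewrite muln_gt0. Qed.

Lemma progression_mod8 n : n == b %[mod M] -> n == a %[mod 8].
Proof.
move=> /eqP nb; apply/eqP.
rewrite -(@modn_dvdm M n 8) ?dvdn_mulr // nb modn_dvdm ?dvdn_mulr //.
exact: chinese_modl coprime8W _ _.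
Qed.

(** Since n = 1 mod q^2 for [q] in [T], periodicity allows [n] to be replaced by 1. *)
Lemma progression_survivor n z : n == b %[mod M] -> (forall q, three_mod4 q ->
  ~~ exactly_divides_diff q (z ^ 2) n) -> survivor T z.
Proof.
move=> /eqP nb notonce; apply/allP => q qT.
have qW : (q ^ 2 %| W)%N by rewrite /W /square_modulus (big_rem q qT) dvdn_mulr.
have n1 : n = 1 %[mod q ^ 2].
  rewrite -(@modn_dvdm M n) ?(dvdn_trans qW) ?dvdn_mull // nb.
  rewrite modn_dvdm ?(dvdn_trans qW) ?dvdn_mull // -(@modn_dvdm W) //.
  by rewrite chinese_modr ?coprime8W // modn_dvdm.
have per := @periodic_exactly_divides_diff q (z ^ 2).
by rewrite -(periodic_mod 1 per) -n1 (periodic_mod n per) notonce // (allP T_three).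
Qed.

Lemma count_representable_le (R : realFieldType) N0 N Z :
  (count (fun n => (n == b %[mod M]) && representable Z n) (iota N0 N))%:R <=
  (count (survivor T) (iota 0 Z.+1))%:R *
  (N%:R / M%:R / selberg_sum (once_density R sieve_prime) (smooth_sets sieve_prime Q)
    + Q%:R ^+ 8) :> R.
Proof.
set rhs := (X in _ * X).
pose F (z : 'I_Z.+1) n := (n == b %[mod M]) &&
  [forall i, ~~ exactly_divides_diff (sieve_prime i) (z ^ 2) n].
apply: le_trans (_ : (\sum_(z < Z.+1 | survivor T z) count (F z) (iota N0 N))%:R <= _).
  rewrite ler_nat; apply: count_union_bound => n /andP[nb].
  move=> /representableP[z [x [y [zZ nE]]]].
  have notonce q : three_mod4 q -> ~~ exactly_divides_diff q (z ^ 2) n.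
    by rewrite nE; apply: sum_three_squares_not_once.
  have zZ' : (z < Z.+1)%N by [].
  exists (Ordinal zZ'); first exact: progression_survivor nb notonce.
  by rewrite /F nb; apply/forallP => i; apply/notonce/sieve_prime_three.
rewrite natr_sum.
apply: le_trans (_ : \sum_(z < Z.+1 | survivor T z) rhs <= _).
  apply: ler_sum => z _; apply: once_sieve => //.
  - exact: sieve_prime_inj.
  - by move=> i; have /andP[] := sieve_prime_three i.
  - by move=> i; apply: three_mod4_ge3; apply: sieve_prime_three.
  - exact: modulus_coprime.
  - by rewrite expn_gt0.
by rewrite sumr_const -[_ *+ _]mulr_natl -[count _ _]/(residue_count Z.+1 (survivor T)) residue_count_card.
Qed.

Lemma count_progression_ge (R : realFieldType) N0 N :
  N%:R / M%:R - 1 <= (count (fun n => n == b %[mod M]) (iota N0 N))%:R :> R.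
Proof.
have := count_periodic_approx R N0 N M_gt0 (@periodic_eqmod M b).
rewrite residue_count_eqmod // mulr1 ler_norml => /andP[lo _].
by move: (count _ _)%:R (_ / _) lo => c y; lra.
Qed.

Lemma selberg_sum_lower (R : realFieldType) :
  harmonic_sum R Q <= 6 * recip_sum R one_mod4.-nat Q * (euler_prod R T)^-1 *
    selberg_sum (once_density R sieve_prime) (smooth_sets sieve_prime Q).
Proof.
apply: harmonic_le_selberg_sum.
- exact: sieve_prime_inj.
- by move=> i; have /andP[] := sieve_prime_three i.
- by move=> i; apply: three_mod4_ge3; apply: sieve_prime_three.
- by apply: sub_all T_three => q /andP[].
move=> q qp qQ; have /or3P[->|->|q3] := prime_mod4 qp; rewrite ?orbT //.
case: (boolP (q \in T)) => qT; rewrite ?orbT //.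
apply/orP; right; apply/orP; right; apply/orP; right; apply/existsP.
have qQ' : (q < Q.+1)%N by [].
have h : three_mod4 (Ordinal qQ') && (nat_of_ord (Ordinal qQ') \notin T).
  by rewrite /three_mod4 /= qp q3.
by exists (exist _ (Ordinal qQ') h); rewrite /sieve_prime /= eqxx.
Qed.

Lemma count_nonrepresentable_progression (R : realFieldType) (C2 N0 N Z : nat) :
  (0 < C2)%N -> survivor_density R T / euler_prod R T <= (4 * (17 * C2))%:R^-1 ->
  ((Z.+1 + W) ^ 2 <= C2 * k)%N -> (8 * M * (Z.+1 + W) <= Q)%N -> (Q ^ 9 <= N)%N ->
  N%:R / M%:R / 2 <= (count (fun n => (n == a %[mod 8]) && ~~ representable Z n) (iota N0 N))%:R :> R.
Proof.
move=> C2_gt0 ratio uC MQ QN.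
have MR : 0 < M%:R :> R by rewrite ltr0n.
have Q_gt0 : (0 < Q)%N by rewrite expn_gt0.
set y : R := N%:R / M%:R; set u : R := (Z.+1 + W)%:R.
set L := selberg_sum (once_density R sieve_prime) (smooth_sets sieve_prime Q).
have uq : u * Q%:R ^+ 8 <= y / 8.
  rewrite /y -mulrA -invfM ler_pdivlMr ?mulr_gt0 // /u -natrX -!natrM ler_nat.
  apply: leq_trans QN; rewrite mulnC mulnA (mulnC M 8) (expnS Q 8).
  by rewrite leq_mul2r MQ orbT.
have L0 : 0 < L.
  apply: selberg_sum_gt0; last by rewrite inE /prime_prod big_set0.
  by apply: once_density_bounds => i; apply: three_mod4_ge3; apply: sieve_prime_three.
have S0 : 0 <= survivor_density R T.
  rewrite /survivor_density big_seq; apply: prodr_ge0 => q /(allP T_three)/three_mod4_ge3 q3.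
  by have /andP[/ltW] := survivor_density_factor_bounds R q3.
have S1 : survivor_density R T <= 1.
  apply: le_trans (_ : \prod_(q <- T) 1 <= _); last by rewrite big1_eq.
  rewrite /survivor_density big_seq [leRHS]big_seq.
  apply: ler_prod => q /(allP T_three)/three_mod4_ge3 q3.
  by have /andP[/ltW-> ->] := survivor_density_factor_bounds R q3.
have N_gt0 : (0 < N)%N by apply: leq_trans QN; rewrite expn_gt0 Q_gt0.
have y0 : 0 < y by rewrite divr_gt0 // ltr0n.
have bad : (count (survivor T) (iota 0 Z.+1))%:R * (y / L + Q%:R ^+ 8) <= 3 / 8 * y.
  apply: (sieve_arithmetic (u := u) (S := survivor_density R T) (E := euler_prod R T)
    (H := harmonic_sum R Q) (B := recip_sum R one_mod4.-nat Q) (k := k%:R) (C2 := C2%:R)) => //.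
  - exact: euler_prod_gt0.
  - exact: harmonic_pow2_gt0.
  - exact: recip_sum_ge0.
  - by rewrite ler1n.
  - exact: count_survivors_le.
  - exact: selberg_sum_lower.
  - by rewrite -!natrM.
  - exact: one_mod4_harmonic_ratio.
  - by rewrite -natrX -natrM ler_nat.
have y8 : 8 <= y.
  rewrite ler_pdivlMr // -natrM ler_nat; apply: leq_trans QN.
  apply: leq_trans (_ : Q <= _)%N; last by rewrite expnS leq_pmulr // expn_gt0 Q_gt0.
  by apply: leq_trans MQ; rewrite leq_pmulr // addSn.
have prog := count_progression_ge R N0 N.
have rep := count_representable_le R N0 N Z.
have split_count : (count (fun n => (n == b %[mod M])) (iota N0 N) <=
    count (fun n => (n == a %[mod 8]) && ~~ representable Z n) (iota N0 N) +
    count (fun n => (n == b %[mod M]) && representable Z n) (iota N0 N))%N.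
  rewrite -count_predUI; apply: leq_trans (leq_addr _ _).
  apply: sub_count => n /= nb; rewrite nb (progression_mod8 nb) /=.
  by case: (representable Z n).
rewrite -(ler_nat R) natrD in split_count.
(* Of at least y - 1 members of the progression at most 3y/8 are representable; y >= 8 absorbs the
   1. *)
have arith (x c1 c2 c3 : R) :
    x - 1 <= c1 -> c1 <= c2 + c3 -> 8 <= x -> c3 <= 3 / 8 * x -> x / 2 <= c2 by lra.
exact: arith prog split_count y8 (le_trans rep bad).
Qed.

End Assembly.

Theorem count_nonrepresentable (C1 : nat) : exists M k0 : nat, (0 < M)%N /\
  forall a k N0 N Z : nat, (k0 <= k)%N -> (2 ^ (9 * k) <= N)%N -> (Z ^ 2 <= C1 * k)%N ->
  (N <= 2 * M * count (fun n => (n == a %[mod 8]) && ~~ representable Z n) (iota N0 N))%N.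
Proof.
(* (Z + 1 + W)^2 <= 2 Z^2 + 2 (W + 1)^2 <= (2 C1 + 2) k as soon as (W + 1)^2 <= k. So [C2], and with
   it [T], depends on [C1] only. *)
pose C2 := (2 * C1 + 2)%N; have C2_gt0 : (0 < C2)%N by rewrite /C2 addn2.
have n0 : (0 < 4 * (17 * C2))%N by rewrite !muln_gt0.
(* The conclusion concerns natural numbers only, so the densities may be taken in [rat]. *)
have [T [uT T3 ratio]] := exists_small_survivor_ratio rat n0.
set W := square_modulus T; pose M := (8 * W)%N.
have M0 : (0 < M)%N by rewrite muln_gt0 square_modulus_gt0.
(* The three summands of the threshold give (W + 1)^2 <= k, 8 M C2 <= k, and k^2 <= 2^k; the last
   two yield 8 M (Z + 1 + W) <= k^2 <= 2^k. *)
exists M, (W.+1 ^ 2 + 8 * M * C2 + 4)%N; split=> // a k N0 N Z kk QN ZC.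
have uC : ((Z.+1 + W) ^ 2 <= C2 * k)%N.
  apply: leq_trans (_ : 2 * Z ^ 2 + 2 * W.+1 ^ 2 <= _)%N.
    have [cauchy _] := nat_Cauchy Z W.+1.
    by rewrite addSnnS sqrnD -mulnDr [(2 * (_ ^ 2 + _))%N]mul2n -addnn leq_add2l.
  have Wk : (W.+1 ^ 2 <= k)%N by apply: leq_trans kk; rewrite -addnA leq_addr.
  by rewrite /C2; rewrite mulnDl -mulnA leq_add ?leq_mul2l ?ZC ?Wk.
have MQ : (8 * M * (Z.+1 + W) <= 2 ^ k)%N.
  apply: leq_trans (sqrn_le_pow2 _); last by apply: leq_trans kk; rewrite leq_addl.
  have Mk : (8 * M * C2 <= k)%N by apply: leq_trans kk; rewrite addnAC leq_addl.
  apply: leq_trans (_ : 8 * M * (C2 * k) <= _)%N.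
    by rewrite leq_mul2l; apply/orP; right; apply: leq_trans uC; rewrite expnS expn1 leq_pmulr // addSn.
  by rewrite mulnA expnS expn1 leq_mul2r Mk orbT.
rewrite mulnC expnM in QN.
have := count_nonrepresentable_progression uT T3 a N0 C2_gt0 ratio uC MQ QN.
rewrite -mulrA -invfM ler_pdivrMr; last by rewrite mulr_gt0 // ltr0n.
by rewrite -!natrM ler_nat mulnC (mulnC M).
Qed.

(** * Passage to real X *)

Lemma ln_natr_le_pow2 (R : realType) (n m : nat) :
  (n <= 2 ^ m)%N -> ln (n%:R : R) <= m%:R.
Proof.
move=> nm; case: (posnP n) => [->|n0]; first by rewrite ln0 ?ler0n.
apply: le_trans (_ : ln ((2 ^ m)%:R : R) <= _).
  by rewrite ler_ln ?posrE ?ltr0n ?expn_gt0 // ler_nat.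
rewrite natrX lnXn // -[_ *+ m]mulr_natl ler_piMr ?ler0n //.
have /(@le_ln1Dx R) : -1 < 1 :> R by lra.
by move=> le; apply: le_trans le; rewrite (_ : 1 + 1 = 2) //; lra.
Qed.

Lemma short_sum3sq_representable (R : realType) (C : R) (C1 k n : nat) :
  0 < C -> 19 * C ^+ 2 <= C1%:R -> (0 < k)%N -> (n <= 2 ^ (9 * k + 10))%N ->
  short_sum3sq C n%:Z ->
  representable (Num.truncn (Num.sqrt (C1 * k)%:R : R)) n.
Proof.
move=> C0 CC1 k0 nk [x [y [z [zle nE]]]].
apply/representableP; exists `|z|%N, `|x|%N, `|y|%N; split; last first.
  by apply/eqP; rewrite -eqz_nat nE !PoszD -!abszX !abszE !ger0_norm ?sqr_ge0.
rewrite truncn_ge_nat ?sqrtr_ge0 //.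
have -> : `|z|%N%:R = `|z|%:~R :> R by rewrite -abszE.
apply: le_trans zle _.
(* ln 2 <= 1 gives ln n <= 9k + 10 <= 19k, which explains the constant 19. *)
have ln_le : ln (n%:~R : R) <= 19 * k%:R.
  rewrite -pmulrn; apply: le_trans (ln_natr_le_pow2 R nk) _.
  by rewrite natrD natrM; have : 1 <= k%:R :> R by [rewrite ler1n|]; lra.
apply: le_trans (_ : C * Num.sqrt (19 * k%:R) <= _).
  by apply: ler_wpM2l; [exact: ltW|exact: ler_wsqrtr].
rewrite -(ger0_norm (ltW C0)) -sqrtr_sqr -sqrtrM ?sqr_ge0 //.
by apply: ler_wsqrtr; rewrite natrM mulrA [_ * 19]mulrC; apply: ler_wpM2r.
Qed.

Local Open Scope classical_set_scope.

Theorem theorem1p3 (R : realType) (C : R) (hC : 0 < C) :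
  exists2 delta : R, 0 < delta &
    forall a0 : int, a0 \in [:: 1; 2; 3; 5; 6] ->
      \forall X \near +oo,
        delta * X <= (#|` fset_set (exceptional C a0 X)|)%:R.
Proof.
pose C1 := (Num.truncn (19 * C ^+ 2)).+1.
have CC1 : 19 * C ^+ 2 <= C1%:R by apply/ltW/truncnS_gt.
have [M [k0 [M0 main]]] := count_nonrepresentable C1.
have M0R : 0 < M%:R :> R by rewrite ltr0n.
(* The count is at least N / (2M), with N >= X - 1 >= X/2. *)
exists (4 * M%:R)^-1; first by rewrite invr_gt0 mulr_gt0.
move=> a0 a0_mem; near=> X.
have X_big : (2 ^ (9 * k0.+1) + 2)%:R <= X by near: X; apply: nbhs_pinfty_ge; exact: num_real.
have X2 : 2 <= X by apply: le_trans X_big; rewrite ler_nat leq_addl.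
(* The integers in the interval from X, excluded, to 2X, included, are those from [N1.+1] to
   [N2]. *)
pose N1 := Num.truncn X; pose N2 := Num.truncn (2 * X).
have N1X : N1%:R <= X by rewrite truncn_le; lra.
have XN1 : X < N1.+1%:R by exact: truncnS_gt.
have N2X : N2%:R <= 2 * X by rewrite truncn_le; lra.
have XN2 : 2 * X < N2.+1%:R by exact: truncnS_gt.
have N12 : (N1 <= N2)%N by apply: le_truncn; lra.
pose N := (N2 - N1)%N.
have NR : N%:R = N2%:R - N1%:R :> R by rewrite natrB.
have N_ge : X - 1 <= N%:R.
  by rewrite NR; move: XN2; rewrite -natr1; lra.
(* This is the largest [k] with 2^(9k) <= N: the sieve level 2^k is as large as the error term
   permits, and [k] is of the order of log X. *)
pose k := (trunc_log 2 N %/ 9)%N.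
have N_gt0 : (0 < N)%N by rewrite -(ltr_nat R); lra.
have kN : (2 ^ (9 * k) <= N)%N.
  apply: leq_trans (trunc_logP (isT : 1 < 2)%N N_gt0).
  by rewrite leq_exp2l // mulnC leq_trunc_div.
have Nk : (N < 2 ^ (9 * k + 9))%N.
  apply: leq_trans (trunc_log_ltn N (isT : 1 < 2)%N) _.
  by rewrite leq_exp2l // addnC -mulnS mulnC ltn_ceil.
have kk : (k0 < k)%N.
  have : (2 ^ (9 * k0.+1) < 2 ^ (9 * k + 9))%N.
    apply: leq_ltn_trans Nk; rewrite -(ler_nat R); apply: le_trans N_ge.
    by move: X_big; rewrite natrD; lra.
  by rewrite ltn_exp2l // addnC -mulnS ltn_mul2l.
pose Z := Num.truncn (Num.sqrt (C1 * k)%:R : R).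
have Z2 : (Z ^ 2 <= C1 * k)%N.
  rewrite -(ler_nat R) natrX -[leRHS]sqr_sqrtr ?ler0n //.
  by apply: lerXn2r; rewrite ?nnegrE ?sqrtr_ge0 //; rewrite truncn_le sqrtr_ge0.
have := main `|a0|%N k N1.+1 N Z (ltnW kk) kN Z2.
rewrite -size_filter; set s := [seq n <- _ | _] => sN.
suff : (size s <= #|` fset_set (exceptional C a0 X)|)%N.
  rewrite -(ler_nat R) => le; apply: le_trans le.
  move: sN; rewrite -(ler_nat R) !natrM => sN.
  rewrite mulrC ler_pdivrMr ?mulr_gt0 //.
  move: (size s)%:R M%:R sN M0R => c m; nra.
rewrite -(size_map Posz); apply: uniq_leq_size.
  by rewrite map_inj_uniq ?filter_uniq ?iota_uniq // => ? ? [].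
move=> _ /mapP[n + ->]; rewrite mem_filter mem_iota => /andP[/andP[na norep] /andP[n1 n2]].
have nN2 : (n <= N2)%N by move: n2; rewrite addSn subnKC // ltnS.
rewrite [_ \in _](in_fset_set (finite_exceptional C a0 X)); apply: mem_set; split.
- apply/andP; split.
    by apply: lt_le_trans XN1 _; rewrite -pmulrn ler_nat.
  by apply: le_trans N2X; rewrite -pmulrn ler_nat.
- have a0E : a0 = `|a0|%N by move: a0_mem; rewrite !inE => /or4P[|||/orP[]] /eqP ->.
  by rewrite a0E !modz_nat (eqP na).
move=> short; move/negP: norep; apply.
apply: short_sum3sq_representable hC CC1 _ _ short; first exact: leq_ltn_trans kk.
apply: leq_trans nN2 _; rewrite -(ler_nat R).
(* n <= 2X <= 2 (N + 1) <= 2 * 2^(9k + 9), the source of the exponent 9k + 10. *)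
apply: le_trans (_ : (2 * N.+1)%:R <= _); last first.
  by rewrite ler_nat addnS expnS leq_mul2l.
by rewrite natrM -natr1; lra.
Unshelve. all: by end_near.
Qed.
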